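(* Let $n$ be an integer greater than $11$. If $\vartheta(B_n,3)\leq 1$, then $\delta(B_n)\geq\delta(A_{n-5})+9$.
   Context: Polygons are treated combinatorially: a convex polygon is a finite set of vertices with a clockwise cyclic order; edges are $2$-element vertex sets, two edges cross if disjoint with alternating vertices in the cyclic order; a triangulation is an inclusion-maximal set of pairwise non-crossing edges; for an interior edge $\varepsilon$ of $T$, $T/\varepsilon$ is obtained by replacing $\varepsilon$ by the other diagonal of the unique quadrilateral with diagonal $\varepsilon$ and sides in $T$ (a flip). For a pair $P=\{U,V\}$, $\delta(P)$ is the minimum number of flips transforming $U$ into $V$; a path realizing it is geodesic. For a vertex $a$ with clockwise successor $b$ and a triangulation $T$, $\mathrm{lk}_T(\{a,b\})$ is the unique vertex $x$ with $\{a,x\},\{b,x\}\in T$; a flip $T\to T'$ is incident to $\{a,b\}$ if the links differ; $\vartheta(P,a)$ is the maximum over geodesic paths between $U$ and $V$ of the number of flips incident to $\{a,b\}$. Deletion: for a vertex $a$ of a polygon with at least $4$ vertices, with clockwise successor $b$, $T\ominus a=\{\varepsilon \text{ with } a \text{ replaced by } b:\varepsilon\in T\setminus\{\{a,b\}\}\}$. Zigzag: for $N\geq 4$, on the polygon with vertices $0,\dots,N-1$ labeled clockwise (mod $N$), $Z_N$ is the triangulation whose interior edges are $\varepsilon_{2k+1}=\{2-k,4+k\}$ and $\varepsilon_{2k+2}=\{1-k,4+k\}$ ($k\geq0$), for indices $1,\dots,N-3$. In a polygon with $N$ vertices, $\bar k=k+\lfloor N/2\rfloor$. Pair $A_n$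 ($n\geq3$): $A_n^-$ is $Z_{n+4}$ with $0,1,\bar0,\bar1$ deleted successively ($\bar k=k+\lfloor (n+4)/2\rfloor$), remaining vertices relabeled clockwise $0,\dots,n-1$ with vertex $2$ keeping label $2$; $A_n^+$ is $Z_{n+4}$ with $4,5,\bar4,\bar5$ deleted successively, relabeled clockwise $0,\dots,n-1$ with former vertex $2$ getting label $1$. Both are triangulations of the polygon with vertices $0,\dots,n-1$; $A_n=\{A_n^-,A_n^+\}$. Pair $B_n$ ($n\geq 7$): let $T=A_{n+1}^-/\{2,5\}/\{2,4\}/\{2,6\}$ (flipped in this order; the last flip introduces $\{1,3\}$, also an edge of $A_{n+1}^+$). With $E=\{\{1,2\},\{2,3\}\}$, $B_n^-=T\setminus E$ and $B_n^+=A_{n+1}^+\setminus E$ are triangulations of the polygon with vertex $2$ removed, whose vertices are relabeled clockwise $0,\dots,n-1$ so that vertex $3$ keeps its label (old $n\mapsto0$, $0\mapsto1$, $1\mapsto2$, $k\mapsto k$ for $3\leq k\leq n-1$). $B_n=\{B_n^-,B_n^+\}$. *)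

(* Defs.v *)
From HB Require Import structures.
From mathcomp Require Import all_boot all_order all_algebra.

Set Implicit Arguments.
Unset Strict Implicit.
Unset Printing Implicit Defensive.

(* A convex polygon is a duplicate-free sequence [p] listing its vertices
   clockwise; only the cyclic order matters, so [p] is meant up to rotation.
   The clockwise successor of [a] is [next p a].  Edges are 2-element sets, and
   a triangulation contains the boundary edges of the polygon. *)
Section Polygon.

Variables (V : finType) (p : seq V).
Implicit Types (a b c d x : V) (e f : {set V}) (T U : {set {set V}}).

Definition clockwise (s : seq V) : bool :=
  has (fun r => subseq s (rot r p)) (iota 0 (size p)).

Definition edges : {set {set V}} :=
  [set e : {set V} | (#|e| == 2) && (e \subset p)].

Definition boundary : {set {set V}} := [set [set a; next p a] | a in p].

Definition cross e f : bool :=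
  [exists a, exists b, exists c, exists d,
    [&& clockwise [:: a; b; c; d], e == [set a; c] & f == [set b; d]]].

Definition noncrossing T : bool :=
  (T \subset edges) && [forall e in T, forall f in T, ~~ cross e f].

Definition triangulation T : bool := maxset noncrossing T.

(* [e] and [f] are the two diagonals of a quadrilateral with sides in [T] *)
Definition quad_diagonals T e f : bool :=
  [exists a, exists b, exists c, exists d,
    [&& clockwise [:: a; b; c; d], e == [set a; c], f == [set b; d],
        [set a; b] \in T, [set b; c] \in T,
        [set c; d] \in T & [set d; a] \in T]].

(* T / e; the [None] case never occurs for an interior edge [e] of a
   triangulation [T], and then the diagonal [f] is unique. *)
Definition flip T e : {set {set V}} :=
  if [pick f | quad_diagonals T e f] is Some f then f |: (T :\ e) else T.

Definition flip_rel T U : bool :=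
  triangulation T && [exists e in T :\: boundary, U == flip T e].

Definition flip_path (P : {set {set V}} * {set {set V}})
    (s : seq {set {set V}}) : bool :=
  path flip_rel P.1 s && (last P.1 s == P.2).

(* The least length of a path of flips from P.1 to P.2.  A shortest path does
   not repeat a triangulation, so it has fewer than #|{set {set V}}| flips, and
   that bound is the value returned only when no path exists. *)
Definition delta (P : {set {set V}} * {set {set V}}) : nat :=
  find (fun k => [exists s : k.-tuple {set {set V}}, flip_path P s])
       (iota 0 #|{: {set {set V}}}|).

(* lk_T({a, b}) with b the successor of a, as an option *)
Definition link T a : option V :=
  [pick x | ([set a; x] \in T) && ([set next p a; x] \in T)].

Definition incident a T U : bool := link T a != link U a.

Definition theta (P : {set {set V}} * {set {set V}}) a : nat :=
  \max_(s : (delta P).-tuple {set {set V}} | flip_path P s)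
     count id (pairmap (incident a) P.1 s).

Definition deletion a T : {set {set V}} :=
  [set [set (if x == a then next p a else x) | x in e]
     | e : {set V} in T :\ [set a; next p a]].

End Polygon.

(* Successive deletion of the vertices in [s], carrying the polygon along. *)
Fixpoint deletions (V : finType) (s : seq V) (p : seq V) (T : {set {set V}}) :
    seq V * {set {set V}} :=
  if s is a :: s' then deletions s' (rem a p) (deletion p a T) else (p, T).

(* From here on the labels 0, ..., n-1 live in 'Z_n, which is the integers
   modulo n only for n >= 2; no smaller n is used. *)
Section Labeled.

Local Open Scope ring_scope.

Definition polygon (n : nat) : seq 'Z_n := enum 'Z_n.

Definition edge (n : nat) (a b : 'Z_n) : {set 'Z_n} := [set a; b].

(* Clockwise relabeling in 'Z_n of the n-vertex polygon [p], with [v] getting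
   label [l]. *)
Definition label (V : finType) (n : nat) (p : seq V) (v : V) (l : 'Z_n) (x : V)
    : 'Z_n :=
  (index x p)%:R - (index v p)%:R + l.

Definition relabel (V : finType) (n : nat) (p : seq V) (v : V) (l : 'Z_n)
    (T : {set {set V}}) : {set {set 'Z_n}} :=
  [set [set label p v l x | x in e] | e : {set V} in T].

Definition zigzag_edge (N j : nat) : {set 'Z_N} :=
  let k := (j.-1)./2 in
  if odd j then edge (2 - k%:R) (4 + k%:R) else edge (1 - k%:R) (4 + k%:R).

Definition zigzag (N : nat) : {set {set 'Z_N}} :=
  boundary (polygon N) :|:
  [set e in [seq zigzag_edge N j | j <- iota 1 (N - 3)]].

Definition bar (N : nat) (k : 'Z_N) : 'Z_N := k + (N./2)%:R.

Arguments bar : clear implicits.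

Definition Aminus (n : nat) : {set {set 'Z_n}} :=
  let N := (n + 4)%N in
  let: (p, T) :=
    @deletions 'Z_N [:: 0; 1; bar N 0; bar N 1] (polygon N) (zigzag N) in
  @relabel 'Z_N n p (2 : 'Z_N) 2 T.

Definition Aplus (n : nat) : {set {set 'Z_n}} :=
  let N := (n + 4)%N in
  let: (p, T) :=
    @deletions 'Z_N [:: 4; 5; bar N 4; bar N 5] (polygon N) (zigzag N) in
  @relabel 'Z_N n p (2 : 'Z_N) 1 T.

Definition pairA (n : nat) : {set {set 'Z_n}} * {set {set 'Z_n}} :=
  (Aminus n, Aplus n).

(* Removes vertex 2 from a triangulation of the (n+1)-gon in which it is an
   ear, and relabels. *)
Definition cut2 (n : nat) (T : {set {set 'Z_n.+1}}) : {set {set 'Z_n}} :=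
  @relabel 'Z_n.+1 n (rem (2 : 'Z_n.+1) (polygon n.+1)) (3 : 'Z_n.+1) 3
    (T :\: [set edge 1 2; edge 2 3]).

Definition Bminus (n : nat) : {set {set 'Z_n}} :=
  let fl := flip (polygon n.+1) in
  cut2 (fl (fl (fl (Aminus n.+1) (edge 2 5)) (edge 2 4)) (edge 2 6)).

Definition Bplus (n : nat) : {set {set 'Z_n}} := cut2 (Aplus n.+1).

Definition pairB (n : nat) : {set {set 'Z_n}} * {set {set 'Z_n}} :=
  (Bminus n, Bplus n).

End Labeled.

(* Main.v *)
(** Since the links of {3,4} in the two triangulations are 6 and n-1, a geodesic
    with at most one flip incident to {3,4} performs exactly one: it replaces
    {3,6} by {4,n-1} in the quadrilateral 3,4,6,n-1.  Contract the polygon by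
    identifying 0,1,2,3 and identifying 4,5,6.  This maps B_n to A_(n-5), and it
    maps a flip to a flip unless two adjacent vertices of its quadrilateral are
    identified, in which case the flip disappears; so it suffices to find nine
    flips that disappear.

    Give a weight to each triangle with two identified vertices: triangles inside
    {0,1,2,3} count 1, the triangle 4,5,6 counts -1, and p < q in one class with
    apex c outside counts -1 or 1 when c lies in a suitable interval depending on
    p and q.  The intervals are additive in (p, q), so the total weight changes by
    at most one in a flip that disappears and not at all in the other flips.  It is
    at most -4 on B_n^- and at least 4 on B_n^+, which gives eight flips; the ninth
    is the one incident to {3,4}: it disappears but does not change the weight. *)

Require Import Defs.
From mathcomp Require Import all_boot all_order all_algebra.
From mathcomp Require Import zify ring.

Set Implicit Arguments.
Unset Strict Implicit.
Unset Printing Implicit Defensive.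

Import Order.TTheory GRing.Theory Num.Theory.

(** * Triangulations as relations on natural numbers *)

(** The weight acts as a potential: each flip that disappears moves it by at most one, so its total
    rise bounds their number whatever their order. Additivity has a simple source: a pair [p < q] in
    {0,1,2,3} owns the apexes [8 - r] for [p <= r < q], and a pair in {4,5,6} owns the apexes
    [n + 2 - r], so splitting a pair splits its set of apexes. These constants are read off the
    triangles of B_n^- on the sides 01, 12, 23 and those of B_n^+ on the sides 45, 56.

    The obstacle is to avoid describing whole triangulations. That B_n^- is a triangulation comes
    from the path itself, whose first flip starts there; flips and contractions preserve maximality,
    so B_n^+ and all images are triangulations as well. Hence one inclusion of edges is enough to
    identify the image of B_n^- or B_n^+ with its counterpart in A_(n-5), and bounding a total
    weight takes only a few explicit edges, which force some triangles and exclude those of the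
    wrong sign. *)

(* Vertices are the numbers below n; [cyc3 a b c] and [cyc4 a b c d] say that the
   listed vertices are distinct and met in this order going clockwise. *)
Definition cyc3 (a b c : nat) : bool :=
  [|| (a < b) && (b < c), (b < c) && (c < a) | (c < a) && (a < b)].

Definition cyc4 (a b c d : nat) : bool := cyc3 a b c && cyc3 a c d.

Definition same_pair (x y a c : nat) : bool :=
  ((x == a) && (y == c)) || ((x == c) && (y == a)).

Record graph (n : nat) (E : rel nat) : Prop := Graph {
  graph_sym : forall x y, E x y -> E y x;
  graph_lt : forall x y, E x y -> x < n;
  graph_neq : forall x y, E x y -> x <> y;
  graph_nx : forall a b c d, cyc4 a b c d -> E a c -> E b d -> False }.

Definition maximal (n : nat) (E : rel nat) : Prop :=
  forall a b, a < n -> b < n -> a <> b ->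
    (forall c d, cyc4 a c b d -> E c d -> False) -> E a b.

Definition triang (n : nat) (E : rel nat) : Prop := graph n E /\ maximal n E.

Record flip_at (E E' : rel nat) (a b c d : nat) : Prop := FlipAt {
  flip_cyc : cyc4 a b c d;
  flip_ac : E a c;
  flip_ab : E a b;
  flip_bc : E b c;
  flip_cd : E c d;
  flip_da : E d a;
  flip_E : forall x y,
    E' x y = same_pair x y b d || (E x y && ~~ same_pair x y a c) }.

Ltac cyc := unfold cyc4, cyc3, same_pair in *; lia.

Section GraphTheory.

Variable n : nat.
Implicit Type E : rel nat.

Lemma graph_ltr E x y : graph n E -> E x y -> y < n.
Proof. by move=> gE /(graph_sym gE) /(graph_lt gE). Qed.

Lemma boundary_edge E a b : triang n E -> a < n -> b < n -> a <> b ->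
  b = a.+1 \/ (a = n.-1 /\ b = 0) -> E a b.
Proof.
move=> [gE mE] an bn neq ab; apply: mE => // c d cy Ecd.
have := graph_lt gE Ecd; have := graph_ltr gE Ecd; cyc.
Qed.

(** Take for [z] the farthest clockwise neighbour of [s] before [t]. An edge crossing [zt] would
    cross [st] or [sz], or else end at [s] and provide a farther neighbour; so [zt] is an edge by
    maximality. *)
Lemma triangle_exists E s t q : triang n E -> E s t -> q < n -> cyc3 s q t ->
  exists z, [/\ cyc3 s z t, E s z & E z t].
Proof.
move=> tE Est qn sqt; have [gE mE] := tE.
have sn := graph_lt gE Est; have tn := graph_ltr gE Est.
pose dist z := if s < z then z - s else z + n - s.
pose P (z : 'I_n) := cyc3 s z t && E s z.
have [z0 Pz0] : exists z, P z.
  have [lt_s|ge_s] := ltnP s.+1 n.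
    exists (Ordinal lt_s); apply/andP; split=> /=; first cyc.
    by apply: (boundary_edge tE) => //; lia.
  have n0 : 0 < n by lia.
  exists (Ordinal n0); apply/andP; split=> /=; first cyc.
  by apply: (boundary_edge tE) => //; cyc.
case: (arg_maxnP (fun z : 'I_n => dist z) Pz0) => z /andP[szt Esz] zmax.
exists z; split=> //; apply: mE => //; first cyc.
move=> c d cy Ecd; have cn := graph_lt gE Ecd; have dn := graph_ltr gE Ecd.
have nx1 := graph_nx gE (b := c) (d := d) _ Est.
have nx2 := graph_nx gE (b := d) (d := c) _ Esz.
have [ds|neq_ds] := eqVneq d s.
  have Pc : P (Ordinal cn) by apply/andP; split=> /=; [clear -szt ds cy;
    cyc|rewrite -ds; exact: (graph_sym gE)].
  have le_cz : dist c <= dist z := zmax _ Pc.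
  by move: le_cz; rewrite /dist; have := ltn_ord z; clear -ds szt cy cn sn;
    case: ifP; case: ifP; cyc.
have [ds'|] := boolP (cyc3 s d z).
  by apply: nx2; [clear -ds' cy szt; cyc|exact: (graph_sym gE)].
move=> nds; apply: nx1 => //; clear -nds neq_ds cy szt; cyc.
Qed.

Lemma flip_rot E E' a b c d : graph n E ->
  flip_at E E' a b c d -> flip_at E E' c d a b.
Proof.
move=> gE [cy ac ab bc cd da EE]; split=> //; first cyc.
- exact: (graph_sym gE).
- by move=> x y; rewrite EE /same_pair; lia.
Qed.

Lemma flip_sym E E' a b c d : graph n E ->
  flip_at E E' a b c d -> flip_at E' E b c d a.
Proof.
move=> gE [cy ac ab bc cd da EE].
have nbd : ~ E b d by move=> bd; exact: (graph_nx gE cy ac bd).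
have ndb : ~ E d b by move=> /(graph_sym gE).
split; rewrite ?EE ?ab ?bc ?cd ?da; try (by clear -cy; cyc).
move=> x y; rewrite EE.
have [/orP[]/andP[/eqP-> /eqP->]|nac] := boolP (same_pair x y a c).
- by rewrite ac /same_pair; cyc.
- by rewrite (graph_sym gE ac) /same_pair; cyc.
have [/orP[]/andP[/eqP-> /eqP->]|nbd'] := boolP (same_pair x y b d).
- by rewrite (negbTE (introN idP nbd)); cyc.
- by rewrite (negbTE (introN idP ndb)); cyc.
by move: nac; rewrite {1}/same_pair orbC => /negbTE nac;
  rewrite {1}/same_pair nac !orFb !andbT.
Qed.

Lemma flip_graph E E' a b c d : graph n E -> flip_at E E' a b c d -> graph n E'.
Proof.
move=> gE fl; have [cy ac ab bc cd da EE] := fl.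
have an := graph_lt gE ac; have bn := graph_lt gE bc.
have cn := graph_lt gE cd; have dn := graph_lt gE da.
have nxE := graph_nx gE.
(* An edge crossing a diagonal but no side is the other diagonal. *)
have across x y : E x y -> cyc4 b x d y -> x = c /\ y = a.
  move=> xy bxdy; split; apply/eqP/negPn/negP => neq.
    have : cyc4 b x c y || cyc4 c x d y by clear -cy bxdy neq; cyc.
    by case/orP=> k; [exact: nxE k bc xy|exact: nxE k cd xy].
  have : cyc4 d y a x || cyc4 a y b x by clear -cy bxdy neq; cyc.
  by case/orP=> k; [apply: nxE k da _|apply: nxE k ab _]; exact: (graph_sym gE).
have sE' x y : E' x y -> E' y x.
  rewrite !EE => /orP[|/andP[xy nac]]; first by rewrite /same_pair; lia.
  by rewrite (graph_sym gE xy); rewrite /same_pair in nac *; lia.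
split=> //.
- move=> x y; rewrite EE => /orP[|/andP[/(graph_lt gE)]] //.
  by rewrite /same_pair; lia.
- move=> x y; rewrite EE => /orP[|/andP[/(graph_neq gE)]] //.
  by cyc.
- move=> x u y v cy'; rewrite !EE.
  case/orP=> [bd|/andP[xy nac]]; case/orP=> [bd'|/andP[uv nac']].
  + by cyc.
  + case/orP: bd => /andP[/eqP ex /eqP ey]; subst x y.
      by have [eu ev] := across _ _ uv cy'; subst; cyc.
    have [||eu ev] := across v u; [exact: (graph_sym gE)|by cyc|].
    by subst; cyc.
  + case/orP: bd' => /andP[/eqP ex /eqP ey]; subst u v.
      have [||eu ev] := across y x; [exact: (graph_sym gE)|by cyc|].
      by subst; cyc.
    by have [||eu ev] := across x y; [|by cyc|subst; cyc].
  + exact: nxE cy' xy uv.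
Qed.

(** For maximality, a pair crossing [ac] but no side of the quadrilateral must be [bd], and [ac]
    itself is now crossed by [bd]. A pair of any other kind is crossed in [E'] as soon as it is
    crossed in [E]. *)
Lemma flip_triang E E' a b c d : triang n E -> flip_at E E' a b c d -> triang n E'.
Proof.
move=> [gE mE] fl; split; first exact: flip_graph fl.
have [cy ac ab bc cd da EE] := fl.
have across' x y :
    (forall u v, E u v -> ~~ same_pair u v a c -> cyc4 x u y v -> False) ->
    cyc4 a x c y -> x = b /\ y = d.
  move=> h axcy; split; apply/eqP/negPn/negP => neq.
    have : cyc4 x b y a || cyc4 x c y b by clear -cy axcy neq; cyc.
    case/orP=> k; first by apply: (h b a) k; [exact: (graph_sym gE)|clear -cy; cyc].
    by apply: (h c b) k; [exact: (graph_sym gE)|clear -cy; cyc].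
  have : cyc4 x c y d || cyc4 x d y a by clear -cy axcy neq; cyc.
  case/orP=> k; first by apply: (h c d) k => //; clear -cy; cyc.
  by apply: (h d a) k => //; clear -cy; cyc.
move=> x y xn yn nxy h.
have h' u v : E u v -> ~~ same_pair u v a c -> cyc4 x u y v -> False.
  by move=> uv nac xuyv; apply: (h u v xuyv); rewrite EE uv nac orbT.
have hbd : ~ cyc4 x b y d.
  by move=> cy'; apply: (h _ _ cy'); rewrite EE /same_pair !eqxx.
have hdb : ~ cyc4 x d y b.
  by move=> cy'; apply: (h _ _ cy'); rewrite EE /same_pair !eqxx orbT.
have [nac|ac'] := boolP (same_pair x y a c); first by exfalso; clear -nac cy hbd hdb;
  cyc.
rewrite EE ac' andbT.
have [cy1|n1] := boolP (cyc4 a x c y).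
  by have [-> ->] := across' _ _ h' cy1; rewrite /same_pair !eqxx.
have [cy2|n2] := boolP (cyc4 a y c x).
  have [|->->] := across' y x _ cy2; last by rewrite /same_pair !eqxx orbT.
  by move=> u v uv nac cy'; apply: (h' v u); [exact: (graph_sym gE)|clear -nac;
    cyc|clear -cy'; cyc].
apply/orP; right; apply: mE => // u v cy' uv.
have [|nac] := boolP (same_pair u v a c).
  by clear -n1 n2 cy'; case/orP=> /andP[/eqP eu /eqP ev]; subst; cyc.
exact: (h' _ _ uv nac cy').
Qed.

(** Weights are attached to increasing triples, so the quadrilateral is rotated until its least
    vertex comes first. A rotation by one step exchanges the two diagonals, which is why the flip
    may appear reversed. *)
Lemma sorted_flip E E' a b c d : triang n E -> flip_at E E' a b c d ->
  exists v1 v2 v3 v4, [/\ v1 < v2, v2 < v3, v3 < v4, v4 < n &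
    flip_at E E' v1 v2 v3 v4 \/ flip_at E' E v1 v2 v3 v4].
Proof.
move=> tE fl; have [gE _] := tE; have [gE' _] := flip_triang tE fl.
have [cy ac ab bc cd da _] := fl.
have an := graph_lt gE ac; have bn := graph_lt gE bc.
have cn := graph_lt gE cd; have dn := graph_lt gE da.
have flr := flip_rot gE fl.
have : [|| [&& a < b, b < c & c < d], [&& b < c, c < d & d < a],
         [&& c < d, d < a & a < b] | [&& d < a, a < b & b < c]].
  by clear -cy; cyc.
case/or4P=> /and3P[h1 h2 h3].
- by exists a, b, c, d; split=> //; left.
- by exists b, c, d, a; split=> //; right; exact: (flip_sym gE).
- by exists c, d, a, b; split=> //; left.
- by exists d, a, b, c; split=> //; right; exact: (flip_sym gE).
Qed.

End GraphTheory.

(** * Images under contractions *)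

Definition push (n : nat) (g : nat -> nat) (E : rel nat) : rel nat :=
  fun u v => (u != v) &&
    has (fun x => has (fun y => [&& E x y, g x == u & g y == v]) (iota 0 n))
        (iota 0 n).

Lemma pushP n g E u v : graph n E ->
  reflect (u <> v /\ exists x y, [/\ E x y, g x = u & g y = v]) (push n g E u v).
Proof.
move=> gE; apply: (iffP andP) =>
  [[/eqP neq /hasP[x _ /hasP[y _ /and3P[xy /eqP ex /eqP ey]]]]|].
  by split=> //; exists x, y.
case=> neq [x [y [xy eu ev]]]; subst u v; split; first exact/eqP.
apply/hasP; exists x; first by rewrite mem_iota /= add0n (graph_lt gE xy).
apply/hasP; exists y; first by rewrite mem_iota /= add0n (graph_ltr gE xy).
by rewrite xy !eqxx.
Qed.

(** The implication goes from images to points: it then says nothing about triples with two equal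
    images, as suits a map that identifies vertices. *)
Record monotone (n m : nat) (g : nat -> nat) : Prop := Monotone {
  mono_lt : forall x, x < n -> g x < m;
  mono_cyc : forall a b c, a < n -> b < n -> c < n ->
    cyc3 (g a) (g b) (g c) -> cyc3 a b c }.

Section Push.

Variables (n m : nat) (g : nat -> nat).
Implicit Type E : rel nat.
Hypothesis mg : monotone n m g.

Lemma push_edge E x y : graph n E -> E x y -> g x <> g y -> push n g E (g x) (g y).
Proof. by move=> gE xy neq; apply/pushP => //; split=> //; exists x, y. Qed.

Lemma push_graph E : graph n E -> graph m (push n g E).
Proof.
move=> gE; split.
- move=> x y /(pushP _ _ _ gE)[neq [u [v [uv eu ev]]]]; subst x y.
  apply/pushP => //; split; first exact: nesym neq.
  by exists v, u; split=> //; exact: (graph_sym gE).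
- by move=> x y /(pushP _ _ _ gE)[_ [u [v [/(graph_lt gE) un <- _]]]];
    exact: (mono_lt mg).
- by move=> x y /(pushP _ _ _ gE)[].
- move=> a b c d abcd /(pushP _ _ _ gE)[_ [a' [c' [ac ea ec]]]].
  case/(pushP _ _ _ gE)=> [_ [b' [d' [bd eb ed]]]].
  have an := graph_lt gE ac; have cn := graph_ltr gE ac.
  have bn := graph_lt gE bd; have dn := graph_ltr gE bd.
  apply: (graph_nx gE _ ac bd).
  move/andP: abcd => [c1 c2]; apply/andP.
  by split; apply: (mono_cyc mg) => //; rewrite ?ea ?eb ?ec ?ed.
Qed.

Lemma mono_cycV a b c : a < n -> b < n -> c < n -> g a <> g b -> g b <> g c ->
  g a <> g c -> cyc3 a b c -> cyc3 (g a) (g b) (g c).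
Proof.
move=> an bn cn ab bc ac abc.
have [h|h] := boolP (cyc3 (g b) (g a) (g c)).
  by move: (mono_cyc mg bn an cn h); clear -abc; cyc.
by clear -h ab bc ac; cyc.
Qed.

(* If an edge leaving the fibre of u separates a vertex q of the fibre of v
   from the rest, the triangle behind it yields either the wanted edge or a
   separating edge of the same kind closer to q. *)
Lemma push_maximal E : triang n E -> (forall u, u < m -> exists2 x, x < n & g x = u) ->
  maximal m (push n g E).
Proof.
move=> tE sg u v um vm uv nx; have [gE mE] := tE.
have [p pn gp] := sg u um; have [q qn gq] := sg v vm.
have done1 x y : E x y -> g x = u -> g y = v -> push n g E u v.
  by move=> xy eu ev; rewrite -eu -ev; apply: push_edge; rewrite ?eu ?ev.
(* [k] bounds the clockwise length of the arc from [s] to [t], which shrinks when [st] is replaced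
   by another side of its triangle. *)
have key : forall k s t, E s t -> cyc3 s q t ->
  (if s < t then t - s else t + n - s) < k ->
    g s = u \/ g t = u -> push n g E u v.
  elim=> // k IHk s t st sqt lek gst.
  have sn := graph_lt gE st; have tn := graph_ltr gE st.
  have [z [szt sz zt]] := triangle_exists tE st qn sqt.
  have zn := graph_ltr gE sz.
  have [ezq|nzq] := eqVneq z q.
    subst z; case: gst => gst; first exact: (done1 s q).
    by apply: (done1 t q) => //; exact: (graph_sym gE).
  have [gsv|nsv] := eqVneq (g s) v.
    case: gst => gst; first by exfalso; apply: uv; rewrite -gst.
    by apply: (done1 t s) => //; exact: (graph_sym gE).
  have [gtv|ntv] := eqVneq (g t) v.
    case: gst => gst; first exact: (done1 s t).
    by exfalso; apply: uv; rewrite -gst.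
  have [gzv|nzv] := eqVneq (g z) v.
    case: gst => gst; first exact: (done1 s z).
    by apply: (done1 t z) => //; exact: (graph_sym gE).
  have [szq|zqt] : cyc3 s z q \/ cyc3 q z t by clear -sqt szt nzq; cyc.
    have rec : g z = u \/ g t = u -> push n g E u v.
      apply: (IHk z t zt); first by clear -szq sqt szt; cyc.
      by move: lek; clear -szq sqt szt sn zn tn; case: ifP; case: ifP; cyc.
    have [gtu|ntu] := eqVneq (g t) u; first by apply: rec; right.
    have [gzu|nzu] := eqVneq (g z) u; first by apply: rec; left.
    case: gst => gst; last by rewrite gst eqxx in ntu.
    (* Here [s] lies over [u], while [z] and [t] lie over neither [u] nor [v]: the image of [zt]
       separates [u] from [v], against [nx]. *)
    have c1 : cyc3 u (g z) v.
      rewrite -gst -gq; apply: mono_cycV => //; rewrite ?gst ?gq;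
        by move: nzu nzv uv; clear; lia.
    have c2 : cyc3 v (g t) u.
      rewrite -gst -gq; apply: mono_cycV; rewrite ?gst ?gq //;
        try (by move: ntu ntv uv; clear; lia); by clear -sqt; cyc.
    exfalso; apply: (nx (g z) (g t)); first by clear -c1 c2; cyc.
    by apply: push_edge => //; clear -c1 c2; cyc.
  have rec : g s = u \/ g z = u -> push n g E u v.
    apply: (IHk s z sz); first by clear -zqt sqt szt; cyc.
    by move: lek; clear -zqt sqt szt sn zn tn; case: ifP; case: ifP; cyc.
  have [gsu|nsu] := eqVneq (g s) u; first by apply: rec; left.
  have [gzu|nzu] := eqVneq (g z) u; first by apply: rec; right.
  case: gst => gst; first by rewrite gst eqxx in nsu.
  have c1 : cyc3 v (g z) u.
    rewrite -gst -gq; apply: mono_cycV => //; rewrite ?gst ?gq;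
      by move: nzu nzv uv; clear; lia.
  have c2 : cyc3 u (g s) v.
    rewrite -gst -gq; apply: mono_cycV; rewrite ?gst ?gq //;
      try (by move: nsu nsv uv; clear; lia); by clear -sqt; cyc.
  exfalso; apply: (nx (g s) (g z)); first by clear -c1 c2; cyc.
  by apply: push_edge => //; clear -c1 c2; cyc.
have npq : p <> q by move=> e; apply: uv; rewrite -gp -gq e.
(* The descent starts from the boundary edge joining [p] to its predecessor: every other vertex lies
   on the clockwise arc from [p] to it. *)
pose t := if p == 0 then n.-1 else p.-1.
have pt : E t p.
  by apply: (boundary_edge tE) => //; rewrite /t; case: eqP; lia.
have [etq|ntq] := eqVneq t q; first by apply: (done1 p q) => //; rewrite -etq;
  exact: (graph_sym gE).
apply: (key _ p t) (ltnSn _) _; [exact: (graph_sym gE)| |by left].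
by move: ntq; rewrite /t; case: (eqVneq p 0); clear -npq pn qn; cyc.
Qed.

Lemma push_triang E : triang n E -> (forall u, u < m -> exists2 x, x < n & g x = u) ->
  triang m (push n g E).
Proof. by move=> tE sg; split; [apply: push_graph; case: tE|exact: push_maximal]. Qed.

(** When two adjacent corners are identified, the new diagonal has the same image as a side, so the
    flip creates no edge in the image. The reverse flip gives the other inclusion. *)
Lemma push_flip_collapsed E E' a b c d : triang n E -> flip_at E E' a b c d ->
  [|| g a == g b, g b == g c, g c == g d | g d == g a] -> push n g E =2 push n g E'.
Proof.
move=> tE fl co.
have half F F' x y z t : triang n F -> flip_at F F' x y z t ->
    [|| g x == g y, g y == g z, g z == g t | g t == g x] ->
    forall u v, push n g F' u v -> push n g F u v.
  move=> tF flF; have [gF _] := tF; have [gF' _] := flip_triang tF flF.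
  have [cy xz xy yz zt tx FF'] := flF.
  have side : [|| g x == g y, g y == g z, g z == g t | g t == g x] ->
      g y <> g t -> push n g F (g y) (g t).
    move=> co' neq; case/or4P: co' => /eqP e.
    - by rewrite -e; apply: push_edge => //; [exact: (graph_sym gF)|rewrite e].
    - by rewrite e; apply: push_edge => //; rewrite -e.
    - by rewrite -e; apply: push_edge => //; rewrite e.
    - by rewrite e; apply: push_edge => //; [exact: (graph_sym gF)|rewrite -e].
  move=> co' u v /(pushP _ _ _ gF')[neq [p [q [pq eu ev]]]]; subst u v.
  move: pq; rewrite FF' => /orP[|/andP[pq _]]; last exact: push_edge.
  case/orP=> /andP[/eqP ep /eqP eq]; subst p q; first exact: side.
  apply: (graph_sym (push_graph gF)); apply: side => //; exact: nesym neq.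
have [gE _] := tE; have fl' := flip_sym gE fl.
move=> u v; apply/idP/idP.
  apply: (half _ _ _ _ _ _ (flip_triang tE fl) fl'); rewrite orbC -!orbA in co *.
  by move: co; clear; lia.
exact: (half _ _ _ _ _ _ tE fl).
Qed.

(** The old diagonal really disappears from the image: an edge of [E'] lying over [g a] and [g c]
    would cross the image of the new diagonal. *)
Lemma push_flip E E' a b c d : triang n E -> flip_at E E' a b c d ->
  cyc4 (g a) (g b) (g c) (g d) ->
  flip_at (push n g E) (push n g E') (g a) (g b) (g c) (g d).
Proof.
move=> tE fl gcy; have [gE _] := tE; have [gE' _] := flip_triang tE fl.
have [cy ac ab bc cd da EE] := fl.
have pe x y := @push_edge E x y gE.
have Ebd : E' b d by rewrite EE /same_pair !eqxx.
have pbd : push n g E' (g b) (g d) by apply: push_edge => //; clear -gcy; cyc.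
split=> //; try (by apply: pe => //; clear -gcy; cyc).
move=> u v; apply/idP/idP.
  move=> puv; case/(pushP _ _ _ gE'): (puv) => neq [x [y [xy eu ev]]]; subst u v.
  move: xy; rewrite EE => /orP[/orP[]/andP[/eqP-> /eqP->]|/andP[xy nac]].
  - by rewrite /same_pair !eqxx.
  - by rewrite /same_pair !eqxx orbT.
  rewrite pe //=; apply/orP; right; apply/negP => sp.
  case/orP: sp => /andP[/eqP ex /eqP ey]; rewrite ex ey in puv.
    exact: (graph_nx (push_graph gE') gcy puv pbd).
  exact: (graph_nx (push_graph gE') gcy (graph_sym (push_graph gE') puv) pbd).
case/orP=> [/orP[]/andP[/eqP-> /eqP->]|/andP[/(pushP _ _ _ gE)[neq [x [y [xy eu ev]]]]
  nac]] //.
  exact: (graph_sym (push_graph gE')).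
subst u v; apply: push_edge => //; rewrite EE xy; apply/orP; right => /=.
by apply/negP=> /orP[]/andP[/eqP ex /eqP ey]; subst; move: nac;
  rewrite /same_pair !eqxx ?orbT.
Qed.

End Push.

(** * Weighted triangle sums *)

(** In a triangulated convex polygon three pairwise adjacent vertices always bound a face.
    Increasing triples list each face once. *)
Definition tri (E : rel nat) (a b c : nat) : bool :=
  [&& a < b, b < c, E a b, E b c & E a c].

Definition phi (n : nat) (w : nat -> nat -> nat -> int) (E : rel nat) : int :=
  (\sum_(t : 'I_n * 'I_n * 'I_n) (tri E t.1.1 t.1.2 t.2)%:Z * w t.1.1 t.1.2 t.2)%R.

Definition flip_gain (w : nat -> nat -> nat -> int) (a b c d : nat) : int :=
  (w a b d + w b c d - w a b c - w a c d)%R.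

Section Phi.

Variable n : nat.
Implicit Types (E : rel nat) (w : nat -> nat -> nat -> int).

(** Any other [x] lies beyond one of the four sides, and its edge to [a] or [c], whichever is off
    that side, crosses the side. *)
Lemma common_neighbour E a b c d x : graph n E -> cyc4 a b c d ->
  E a b -> E b c -> E c d -> E d a -> E x a -> E x c -> x = b \/ x = d.
Proof.
move=> gE cy ab bc cd da xa xc.
have nxa := graph_neq gE xa; have nxc := graph_neq gE xc.
have nx := graph_nx gE.
have ax := graph_sym gE xa; have cx := graph_sym gE xc.
have [->|nb] := eqVneq x b; first by left.
have [->|nd] := eqVneq x d; first by right.
exfalso; have [h|h] : cyc3 a x c \/ cyc3 c x a by clear -cy nxa nxc; cyc.
  have [k|k] : cyc4 a x b c \/ cyc4 b x c a by clear -cy h nb; cyc.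
    exact: nx k ab xc.
  exact: nx k bc xa.
have [k|k] : cyc4 c x d a \/ cyc4 d x a c by clear -cy h nd; cyc.
  exact: nx k cd xa.
exact: nx k da xc.
Qed.

(** By [common_neighbour], a diagonal of the quadrilateral lies in only two triangles, namely its
    two halves; every triangle without a diagonal survives. Since the corners are increasing, these
    halves are the listed triples. *)
Lemma tri_flip E E' v1 v2 v3 v4 : triang n E -> flip_at E E' v1 v2 v3 v4 ->
  v1 < v2 -> v2 < v3 -> v3 < v4 -> forall a b c,
  ((tri E' a b c)%:Z = (tri E a b c)%:Z
     + ((a, b, c) == (v1, v2, v4))%:Z + ((a, b, c) == (v2, v3, v4))%:Z
     - ((a, b, c) == (v1, v2, v3))%:Z - ((a, b, c) == (v1, v3, v4))%:Z)%R.
Proof.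
move=> tE fl l12 l23 l34 a b c; have [gE _] := tE; have [gE' _] := flip_triang tE fl.
have fl' := flip_sym gE fl.
have [cy e13 e12 e23 e34 e41 EE] := fl.
have [_ f24 f23 f34 f41 f12 _] := fl'.
have n24 : E v2 v4 = false by apply/negP => e; exact: (graph_nx gE cy e13 e).
have f13 : E' v1 v3 = false by apply/negP => e; exact: (graph_nx gE' cy e f24).
have e14 := graph_sym gE e41; have f14 := graph_sym gE' f41.
rewrite !xpair_eqE.
have [/andP[/andP[/eqP-> /eqP->] /eqP->]|n1] :=
  boolP ((a == v1) && (b == v2) && (c == v4)).
  by rewrite /tri f12 f24 f14 n24; clear -l12 l23 l34; lia.
have [/andP[/andP[/eqP-> /eqP->] /eqP->]|n2] :=
  boolP ((a == v2) && (b == v3) && (c == v4)).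
  by rewrite /tri f23 f34 f24 n24; clear -l12 l23 l34; lia.
have [/andP[/andP[/eqP-> /eqP->] /eqP->]|n3] :=
  boolP ((a == v1) && (b == v2) && (c == v3)).
  by rewrite /tri e12 e23 e13 f13; clear -l12 l23 l34; lia.
have [/andP[/andP[/eqP-> /eqP->] /eqP->]|n4] :=
  boolP ((a == v1) && (b == v3) && (c == v4)).
  by rewrite /tri e13 e34 e14 f13; clear -l12 l23 l34; lia.
suff -> : tri E' a b c = tri E a b c by move: (tri E a b c) => k; clear; lia.
apply/idP/idP => /and5P[ltab ltbc ab bc ac].
  have cn := @common_neighbour E' v2 v3 v4 v1 _ gE' (flip_cyc fl') f23 f34 f41 f12.
  have keep x y : E' x y -> ~~ same_pair x y v2 v4 -> E x y.
    by rewrite EE => /orP[->|/andP[]].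
  have ba := graph_sym gE' ab; have cb := graph_sym gE' bc; have ca := graph_sym gE' ac.
  apply/and5P; split=> //; apply: keep => //;
    apply/negP=> /orP[]/andP[/eqP e1 /eqP e2]; subst.
  - by case: (cn _ ca cb) => ?; subst; move: n1 n2 n3 n4 ltab ltbc;
      clear -l12 l23 l34; lia.
  - by clear -ltab l23 l34; lia.
  - by case: (cn _ ab ac) => ?; subst; move: n1 n2 n3 n4 ltab ltbc;
      clear -l12 l23 l34; lia.
  - by clear -ltbc l23 l34; lia.
  - by case: (cn _ ba bc) => ?; subst; move: n1 n2 n3 n4 ltab ltbc;
      clear -l12 l23 l34; lia.
  - by clear -ltab ltbc l23 l34; lia.
have cn := @common_neighbour E v1 v2 v3 v4 _ gE cy e12 e23 e34 e41.
have keep x y : E x y -> ~~ same_pair x y v1 v3 -> E' x y.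
  by rewrite EE => -> ->; rewrite orbT.
have ba := graph_sym gE ab; have cb := graph_sym gE bc; have ca := graph_sym gE ac.
apply/and5P; split=> //; apply: keep => //;
  apply/negP=> /orP[]/andP[/eqP e1 /eqP e2]; subst.
- by case: (cn _ ca cb) => ?; subst; move: n1 n2 n3 n4 ltab ltbc; clear -l12 l23 l34;
    lia.
- by clear -ltab l23 l12; lia.
- by case: (cn _ ab ac) => ?; subst; move: n1 n2 n3 n4 ltab ltbc; clear -l12 l23 l34;
    lia.
- by clear -ltbc l23 l12; lia.
- by case: (cn _ ba bc) => ?; subst; move: n1 n2 n3 n4 ltab ltbc; clear -l12 l23 l34;
    lia.
- by clear -ltab ltbc l12 l23; lia.
Qed.

Lemma sum_triple (w : nat -> nat -> nat -> int) a b c : a < n -> b < n -> c < n ->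
  (\sum_(t : 'I_n * 'I_n * 'I_n)
     (((nat_of_ord t.1.1, nat_of_ord t.1.2, nat_of_ord t.2) == (a, b, c))%:Z
        * w t.1.1 t.1.2 t.2) = w a b c)%R.
Proof.
move=> an bn cn; rewrite (bigD1 (Ordinal an, Ordinal bn, Ordinal cn)) //=.
rewrite eqxx mul1r big1 ?addr0 // => -[[x y] z] /= neq.
case: eqP => [[ex ey ez]|_]; last by rewrite mul0r.
by case/eqP: neq; congr (_, _, _); exact: val_inj.
Qed.

Lemma phi_flip w E E' v1 v2 v3 v4 : triang n E -> flip_at E E' v1 v2 v3 v4 ->
  v1 < v2 -> v2 < v3 -> v3 < v4 ->
  phi n w E' = (phi n w E + flip_gain w v1 v2 v3 v4)%R.
Proof.
move=> tE fl l12 l23 l34; have [gE _] := tE.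
have v4n := graph_ltr gE (flip_cd fl).
have v3n : v3 < n by lia.
have v2n : v2 < n by lia.
have v1n : v1 < n by lia.
rewrite /phi (eq_bigr (fun t : 'I_n * 'I_n * 'I_n =>
   (tri E t.1.1 t.1.2 t.2)%:Z * w t.1.1 t.1.2 t.2
   + ((nat_of_ord t.1.1, nat_of_ord t.1.2, nat_of_ord t.2) == (v1, v2,
     v4))%:Z * w t.1.1 t.1.2 t.2
   + ((nat_of_ord t.1.1, nat_of_ord t.1.2, nat_of_ord t.2) == (v2, v3,
     v4))%:Z * w t.1.1 t.1.2 t.2
   - ((nat_of_ord t.1.1, nat_of_ord t.1.2, nat_of_ord t.2) == (v1, v2,
       v3))%:Z * w t.1.1 t.1.2 t.2
   - ((nat_of_ord t.1.1, nat_of_ord t.1.2, nat_of_ord t.2) == (v1, v3,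
       v4))%:Z * w t.1.1 t.1.2 t.2)%R);
  last by move=> t _; rewrite (tri_flip tE fl) // !mulrBl !mulrDl.
by rewrite !sumrB !big_split /= !sum_triple // /flip_gain !addrA.
Qed.

Lemma sum_mem (L : seq (nat * nat * nat)) : uniq L ->
  all (fun t => [&& t.1.1 < n, t.1.2 < n & t.2 < n]) L ->
  (\sum_(t : 'I_n * 'I_n * 'I_n)
     ((nat_of_ord t.1.1, nat_of_ord t.1.2, nat_of_ord t.2) \in L)%:Z
   = (size L)%:Z)%R.
Proof.
elim: L => [|[[a b] c] L IHL] /=; first by rewrite big1.
case/andP=> nL uL /andP[/and3P[an bn cn] /IHL {}IHL].
rewrite -add1n PoszD -IHL // -[Posz 1](@sum_triple (fun _ _ _ =>
  1%R) a b c an bn cn) -big_split /=.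
apply: eq_bigr => -[[x y] z] _ /=; rewrite mulr1 inE.
by case: eqP => [->|] //=; rewrite (negbTE nL).
Qed.

(** This bounds a total weight without a complete list of triangles: [L] collects some triangles of
    weight at least 1, and the others only have to be of nonnegative weight. *)
Lemma phi_ge w E (L : seq (nat * nat * nat)) : uniq L ->
  all (fun t => [&& t.1.1 < n, t.1.2 < n & t.2 < n]) L ->
  (forall t, t \in L -> tri E t.1.1 t.1.2 t.2) ->
  (forall a b c, tri E a b c -> (((a, b, c) \in L)%:Z <= w a b c)%R) ->
  ((size L)%:Z <= phi n w E)%R.
Proof.
move=> uL aL tL wL; rewrite -sum_mem //; apply: ler_sum => -[[a b] c] _ /=.
have [/wL h|nt] := boolP (tri E a b c); first by rewrite mul1r.
by rewrite mul0r; have [/tL|] := boolP (_ \in L); rewrite ?(negbTE nt).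
Qed.

Lemma phiN w E : phi n (fun a b c => - w a b c)%R E = (- phi n w E)%R.
Proof. by rewrite /phi -sumrN; apply: eq_bigr => t _; rewrite mulrN. Qed.

End Phi.

(** * The pairs [A] and [B] *)

(* [k] modulo [m], for [k < 2m]. *)
Definition wrap (m k : nat) : nat := if k < m then k else k - m.

(** [r] is a lift of the map to the integers, nondecreasing and spanning at most one full turn. The
    span may equal [m], in which case the last vertices are identified with the first ones. *)
Lemma wrap_monotone n m (r : nat -> nat) :
  (forall x y, x <= y -> y < n -> r x <= r y) ->
  (forall x, x < n -> r x < m + m) ->
  (forall x y, x < n -> y < n -> r x <= r y + m) ->
  monotone n m (fun x => wrap m (r x)).
Proof.
move=> r_mono r_lt r_bd; split=> [x /r_lt|a b c an bn cn].
  by rewrite /wrap; case: ifP; lia.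
have := r_lt _ an; have := r_lt _ bn; have := r_lt _ cn.
have := r_bd _ _ an bn; have := r_bd _ _ bn cn; have := r_bd _ _ cn an.
have := r_bd _ _ bn an; have := r_bd _ _ cn bn; have := r_bd _ _ an cn.
have := r_mono a b; have := r_mono b c; have := r_mono c a.
have := r_mono b a; have := r_mono c b; have := r_mono a c.
rewrite an bn cn; move: (r a) (r b) (r c) => ra rb rc; clear -an bn cn.
by rewrite /wrap /cyc3; case: ifP; case: ifP; case: ifP; lia.
Qed.

(* The interior edges of the zigzag are the pairs with sum 5 or 6 modulo [N]. *)
Definition zig_rel (N : nat) : rel nat := fun x y =>
  [&& x < N, y < N, x != y &
   [|| x.+1 == y, y.+1 == x, (x == 0) && (y == N.-1), (y == 0) && (x == N.-1) |
       x + y \in [:: 5; 6; N + 5; N + 6]]].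

(** Lift clockwise vertices to integers a < b < c < d < a + N. Then (b + d) - (a + c) lies between 2
    and N - 2, whereas the sums of two interior edges differ by at most 1 modulo N. Boundary edges
    cross nothing. *)
Lemma zig_rel_graph N : 10 < N -> graph N (zig_rel N).
Proof.
move=> N10; split; rewrite /zig_rel ?inE.
- by move=> x y; rewrite !inE; lia.
- by move=> x y /and4P[].
- by move=> x y /and4P[_ _ /eqP].
move=> a b c d; rewrite /cyc4 /cyc3 !inE =>
  cy /and4P[an cn nac hac] /and4P[bn dn nbd hbd].
have {}hac : [|| a + c == 5, a + c == 6, a + c == N + 5 | a + c == N + 6] by lia.
have {}hbd : [|| b + d == 5, b + d == 6, b + d == N + 5 | b + d == N + 6] by lia.
by lia.
Qed.

(* Up to [wrap], the labels in [A_m^-] and [A_m^+] of the vertex [x] of the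
   zigzag, where [H] is half the number of its vertices. *)
Definition Aminus_pos (H x : nat) : nat :=
  if x <= 2 then 2 else if x < H then x else if x <= H + 2 then H else x - 2.

Definition Aplus_pos (m H x : nat) : nat :=
  if x <= 3 then x + m - 1 else if x <= 6 then m + 3 else
  if x <= H + 3 then x + m - 3 else if x <= H + 6 then m + H + 1 else x + m - 5.

Definition Aminus_map (n x : nat) : nat := wrap n (Aminus_pos (n + 4)./2 x).
Definition Aplus_map (n x : nat) : nat := wrap n (Aplus_pos n (n + 4)./2 x).

Lemma Aminus_map_monotone n : 6 < n -> monotone (n + 4) n (Aminus_map n).
Proof.
move=> n6; have : (n + 4)./2 * 2 <= n + 4 <= (n + 4)./2 * 2 + 1 by lia.
rewrite /Aminus_map; move: (n + 4)./2 => H hH; apply: wrap_monotone.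
- by move=> x y; rewrite /Aminus_pos; do ![case: ifP]; lia.
- by move=> x; rewrite /Aminus_pos; do ![case: ifP]; lia.
- by move=> x y; rewrite /Aminus_pos; do ![case: ifP]; lia.
Qed.

Lemma Aplus_map_monotone n : 6 < n -> monotone (n + 4) n (Aplus_map n).
Proof.
move=> n6; have : (n + 4)./2 * 2 <= n + 4 <= (n + 4)./2 * 2 + 1 by lia.
rewrite /Aplus_map; move: (n + 4)./2 => H hH; apply: wrap_monotone.
- by move=> x y; rewrite /Aplus_pos; do ![case: ifP]; lia.
- by move=> x; rewrite /Aplus_pos; do ![case: ifP]; lia.
- by move=> x y; rewrite /Aplus_pos; do ![case: ifP]; lia.
Qed.

Definition Aminus_rel (n : nat) : rel nat :=
  push (n + 4) (Aminus_map n) (zig_rel (n + 4)).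
Definition Aplus_rel (n : nat) : rel nat :=
  push (n + 4) (Aplus_map n) (zig_rel (n + 4)).

Lemma Aminus_rel_graph n : 6 < n -> graph n (Aminus_rel n).
Proof. by move=> n6; apply: push_graph (Aminus_map_monotone n6) _ _;
  apply: zig_rel_graph; lia. Qed.

Lemma Aplus_rel_graph n : 6 < n -> graph n (Aplus_rel n).
Proof. by move=> n6; apply: push_graph (Aplus_map_monotone n6) _ _;
  apply: zig_rel_graph; lia. Qed.

Definition switch (E : rel nat) (a b c d : nat) : rel nat := fun x y =>
  same_pair x y b d || (E x y && ~~ same_pair x y a c).

(* The removed ear 2 is sent to the label of its neighbour 3. *)
Definition cut_map (n x : nat) : nat :=
  wrap n (if x <= 1 then x.+1 else if x == 2 then 3 else x).

Lemma cut_map_monotone n : 6 < n -> monotone n.+1 n (cut_map n).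
Proof.
move=> n6; apply: wrap_monotone.
- by move=> x y; do ![case: ifP]; lia.
- by move=> x; do ![case: ifP]; lia.
- by move=> x y; do ![case: ifP]; lia.
Qed.

(** The three flips exchange 25 for 46, then 24 for 36, then 26 for 13; the last one turns 2 into an
    ear. *)
Definition precut_rel (n : nat) : rel nat :=
  switch (switch (switch (Aminus_rel n.+1) 2 4 5 6) 2 3 4 6) 2 3 6 1.

Definition Bminus_rel (n : nat) : rel nat := push n.+1 (cut_map n) (precut_rel n).
Definition Bplus_rel (n : nat) : rel nat := push n.+1 (cut_map n) (Aplus_rel n.+1).

(** The classes {0,1,2,3} and {4,5,6} receive the numbers 2 and 3, and the remaining vertices follow
    clockwise, so that the images of B_n^- and B_n^+ come out with the labels of A_(n-5). *)
Definition contr (n x : nat) : nat :=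
  wrap (n - 5) (if x <= 3 then 2 else if x <= 6 then 3 else x - 3).

Lemma contr_monotone n : 11 < n -> monotone n (n - 5) (contr n).
Proof.
move=> n11; apply: wrap_monotone.
- by move=> x y; do ![case: ifP]; lia.
- by move=> x; do ![case: ifP]; lia.
- by move=> x y; do ![case: ifP]; lia.
Qed.

Lemma contr_surj n u : 11 < n -> u < n - 5 -> exists2 x, x < n & contr n x = u.
Proof.
move=> n11 um; exists (if u <= 1 then u + n - 2 else if u == 2 then 0 else u + 3).
  by do ![case: ifP]; lia.
by rewrite /contr /wrap; do ![case: ifP]; lia.
Qed.

(** The classes are intervals of numbers, so identifying the extreme vertices [v1] and [v4] would
    put all four in one class. *)
Lemma contr_cyc n v1 v2 v3 v4 : 11 < n ->
  v1 < v2 -> v2 < v3 -> v3 < v4 -> v4 < n ->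
  contr n v1 != contr n v2 -> contr n v2 != contr n v3 ->
  contr n v3 != contr n v4 ->
  cyc4 (contr n v1) (contr n v2) (contr n v3) (contr n v4).
Proof.
move=> n11 l12 l23 l34 l4n; rewrite /contr.
pose r x := if x <= 3 then 2 else if x <= 6 then 3 else x - 3.
have r_le x y : x < y -> r x <= r y by rewrite /r; do ![case: ifP]; lia.
have r_ge x : 2 <= r x by rewrite /r; do ![case: ifP]; lia.
have r_lt x : x < n -> r x < n - 5 + 2 by rewrite /r; do ![case: ifP]; lia.
rewrite -/(r v1) -/(r v2) -/(r v3) -/(r v4).
move: (r_le _ _ l12) (r_le _ _ l23) (r_le _ _ l34) (r_lt _ l4n) (r_ge v1).
move: (r v1) (r v2) (r v3) (r v4) (n - 5) => a b c d m; clear.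
rewrite /cyc4 /cyc3 /wrap; do ![case: ifP]; lia.
Qed.

(* For [a < b < c].  The apex intervals are chosen so that the triangles (0,1,8),
   (1,2,7), (2,3,6) of [B_n^-] get -1 and (4,5,n-2), (5,6,n-3) of [B_n^+] get 1. *)
Definition weight (n a b c : nat) : int :=
  if c <= 3 then 1%R else
  if b <= 3 then (if (9 - b <= c) && (c <= 8 - a) then (-1)%R else 0%R) else
  if (a < 4) || (6 < b) then 0%R else
  if c <= 6 then (-1)%R else
  if (n + 3 - b <= c) && (c <= n + 2 - a) then 1%R else 0%R.

(* The apex interval of (p, r) is the disjoint union of those of (p, q) and
   (q, r) when p < q < r are in the same class. *)
Lemma weight_gain n v1 v2 v3 v4 : 11 < n ->
  v1 < v2 -> v2 < v3 -> v3 < v4 -> v4 < n ->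
  (`|flip_gain (weight n) v1 v2 v3 v4| <=
    [|| contr n v1 == contr n v2, contr n v2 == contr n v3 |
        contr n v3 == contr n v4]%:Z)%R.
Proof.
move=> n11 l12 l23 l34 l4n.
have coll x y : (y <= 3) || (3 < x) && (y <= 6) -> x < y -> contr n x == contr n y.
  by rewrite /contr => h xy; apply/eqP; congr wrap; do ![case: ifP]; lia.
have [h|h] := boolP ((v2 <= 3) || (3 < v1) && (v2 <= 6)).
  rewrite coll //= /flip_gain /weight; clear coll.
  by do ![case: ifP] => *; lia.
have [h'|h'] := boolP ((3 < v2) && (v3 <= 6)).
  rewrite (coll v2 v3) ?h' ?orbT // /flip_gain /weight; clear coll.
  by do ![case: ifP] => *; lia.
(* Now [v2 > 3] and [v3 > 6], so no two adjacent corners are identified: [v3] and [v4] in one class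
   would put [v3] at 6 or below. The four triangles then have weight 0. *)
suff -> : flip_gain (weight n) v1 v2 v3 v4 = 0%R by case: (_ || _).
by rewrite /flip_gain /weight; clear coll; do ![case: ifP] => *; lia.
Qed.

(** * Explicit edges of the pairs A_(n+1) and B_n *)

Lemma Aminus_relI n x y u v : 6 < n -> zig_rel (n + 4) x y -> Aminus_map n x = u ->
  Aminus_map n y = v -> u <> v ->
  Aminus_rel n u v.
Proof.
move=> n6 xy <- <- neq; apply: push_edge => //; apply: zig_rel_graph; lia.
Qed.

Lemma Aplus_relI n x y u v : 6 < n -> zig_rel (n + 4) x y -> Aplus_map n x = u ->
  Aplus_map n y = v -> u <> v ->
  Aplus_rel n u v.
Proof.
move=> n6 xy <- <- neq; apply: push_edge => //; apply: zig_rel_graph; lia.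
Qed.

Ltac minus_lia := rewrite /Aminus_map /Aminus_pos /wrap; do ![case: ifP]; try lia;
  rewrite /=; lia.
Ltac plus_lia := rewrite /Aplus_map /Aplus_pos /wrap; do ![case: ifP]; try lia;
  rewrite /=; lia.
Ltac zig_lia := rewrite /zig_rel !inE; lia.

Lemma Aminus_rel_mem n : 11 < n ->
  [/\ Aminus_rel n.+1 2 4, Aminus_rel n.+1 2 5, Aminus_rel n.+1 2 6,
    Aminus_rel n.+1 1 6 & Aminus_rel n.+1 1 7] /\
  [/\ Aminus_rel n.+1 0 7, Aminus_rel n.+1 0 8 & Aminus_rel n.+1 n 8].
Proof.
move=> n11; have n6 : 6 < n.+1 by lia.
split; split.
(* Each witness is an edge of the zigzag on [n + 5] vertices: its sum is 5, 6, [n + 10] or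
   [n + 11]. *)
- by apply: (@Aminus_relI _ 1 4); [|zig_lia|minus_lia|minus_lia|lia].
- by apply: (@Aminus_relI _ 0 5); [|zig_lia|minus_lia|minus_lia|lia].
- by apply: (@Aminus_relI _ 0 6); [|zig_lia|minus_lia|minus_lia|lia].
- by apply: (@Aminus_relI _ (n + 4) 6); [|zig_lia|minus_lia|minus_lia|lia].
- by apply: (@Aminus_relI _ (n + 4) 7); [|zig_lia|minus_lia|minus_lia|lia].
- by apply: (@Aminus_relI _ (n + 3) 7); [|zig_lia|minus_lia|minus_lia|lia].
- by apply: (@Aminus_relI _ (n + 3) 8); [|zig_lia|minus_lia|minus_lia|lia].
- by apply: (@Aminus_relI _ (n + 2) 8); [|zig_lia|minus_lia|minus_lia|lia].
Qed.

Lemma Aplus_rel_mem n : 11 < n ->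
  [/\ Aplus_rel n.+1 n 3, Aplus_rel n.+1 0 3, Aplus_rel n.+1 1 3,
    Aplus_rel n.+1 3 (n - 1) & Aplus_rel n.+1 4 (n - 1)] /\
  [/\ Aplus_rel n.+1 4 (n - 2), Aplus_rel n.+1 5 (n - 2), Aplus_rel n.+1 5 (n - 3) &
    Aplus_rel n.+1 6 (n - 3)].
Proof.
move=> n11; have n6 : 6 < n.+1 by lia.
split; split.
- by apply: (@Aplus_relI _ 0 5); [|zig_lia|plus_lia|plus_lia|lia].
- by apply: (@Aplus_relI _ 1 4); [|zig_lia|plus_lia|plus_lia|lia].
- by apply: (@Aplus_relI _ 2 4); [|zig_lia|plus_lia|plus_lia|lia].
- by apply: (@Aplus_relI _ 6 (n + 4)); [|zig_lia|plus_lia|plus_lia|lia].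
- by apply: (@Aplus_relI _ 7 (n + 4)); [|zig_lia|plus_lia|plus_lia|lia].
- by apply: (@Aplus_relI _ 7 (n + 3)); [|zig_lia|plus_lia|plus_lia|lia].
- by apply: (@Aplus_relI _ 8 (n + 3)); [|zig_lia|plus_lia|plus_lia|lia].
- by apply: (@Aplus_relI _ 8 (n + 2)); [|zig_lia|plus_lia|plus_lia|lia].
- by apply: (@Aplus_relI _ 9 (n + 2)); [|zig_lia|plus_lia|plus_lia|lia].
Qed.

Lemma Aminus_rel_boundary n a : 6 < n -> a.+1 < n -> Aminus_rel n a a.+1.
Proof.
move=> n6 an; pose H := (n + 4)./2.
(* [x] is a zigzag vertex with label [a] whose successor has label [a + 1]. For [a = 1] it is the
   last vertex [n + 3], and the successor 0 has been merged into 2. *)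
pose x := if a <= 1 then a + n + 2 else if a < H then a else a + 2.
apply: (@Aminus_relI _ x (if a == 1 then 0 else x.+1)) => //; rewrite /x /H.
- by do ![case: ifP]; zig_lia.
- by rewrite /Aminus_map /Aminus_pos /wrap; do ![case: ifP]; lia.
- by rewrite /Aminus_map /Aminus_pos /wrap; do ![case: ifP]; lia.
Qed.

Lemma switch_flip_at (E : rel nat) a b c d : cyc4 a b c d -> E a c -> E a b ->
  E b c -> E c d -> E d a ->
  flip_at E (switch E a b c d) a b c d.
Proof. by move=> *; split. Qed.

Lemma precut_flips n : 11 < n ->
  let E1 := switch (Aminus_rel n.+1) 2 4 5 6 in let E2 := switch E1 2 3 4 6 in
  [/\ flip_at (Aminus_rel n.+1) E1 2 4 5 6, flip_at E1 E2 2 3 4 6 &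
      flip_at E2 (precut_rel n) 2 3 6 1].
Proof.
move=> n11; have n6 : 6 < n.+1 by lia.
have [[a24 a25 a26 a16 _] _] := Aminus_rel_mem n11.
have a45 : Aminus_rel n.+1 4 5 by apply: Aminus_rel_boundary; lia.
have a56 : Aminus_rel n.+1 5 6 by apply: Aminus_rel_boundary; lia.
have a23 : Aminus_rel n.+1 2 3 by apply: Aminus_rel_boundary; lia.
have a34 : Aminus_rel n.+1 3 4 by apply: Aminus_rel_boundary; lia.
have a12 : Aminus_rel n.+1 1 2 by apply: Aminus_rel_boundary; lia.
have a62 := graph_sym (Aminus_rel_graph n6) a26;
  have a61 := graph_sym (Aminus_rel_graph n6) a16.
by split; apply: switch_flip_at;
  rewrite // /switch ?a24 ?a25 ?a26 ?a45 ?a56 ?a23 ?a34 ?a12 ?a62 ?a61.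
Qed.

Lemma precut_graph n : 11 < n -> graph n.+1 (precut_rel n).
Proof.
move=> n11; have [f1 f2 f3] := precut_flips n11.
by apply: flip_graph f3; apply: flip_graph f2; apply: flip_graph f1;
  apply: Aminus_rel_graph; lia.
Qed.

Lemma Bminus_rel_graph n : 11 < n -> graph n (Bminus_rel n).
Proof.
by move=> n11; apply: push_graph (precut_graph n11); apply: cut_map_monotone; lia.
Qed.

Lemma Bplus_rel_graph n : 11 < n -> graph n (Bplus_rel n).
Proof.
by move=> n11; apply: push_graph (Aplus_rel_graph _); [apply: cut_map_monotone;
  lia|lia].
Qed.

Lemma Bminus_relI n x y u v : 11 < n -> precut_rel n x y -> cut_map n x = u ->
  cut_map n y = v -> u <> v ->
  Bminus_rel n u v.
Proof. by move=> n11 xy <- <- neq; apply: push_edge => //; exact: precut_graph. Qed.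

Lemma Bplus_relI n x y u v : 11 < n -> Aplus_rel n.+1 x y -> cut_map n x = u ->
  cut_map n y = v -> u <> v ->
  Bplus_rel n u v.
Proof. by move=> n11 xy <- <- neq; apply: push_edge => //; apply: Aplus_rel_graph;
  lia. Qed.

Ltac cut_lia := rewrite /cut_map /wrap; do ![case: ifP]; try lia; rewrite /=; lia.

Lemma Bminus_rel_mem n : 11 < n ->
  [/\ Bminus_rel n 3 6, Bminus_rel n 4 6, Bminus_rel n 2 6 &
    Bminus_rel n 2 7] /\ [/\ Bminus_rel n 1 7, Bminus_rel n 1 8 & Bminus_rel n 0 8].
Proof.
move=> n11; have [[_ _ _ a16 a17] [a07 a08 an8]] := Aminus_rel_mem n11.
have p x y : Aminus_rel n.+1 x y -> x != 2 -> y != 2 -> precut_rel n x y.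
  by move=> xy x2 y2; rewrite /precut_rel /switch xy /same_pair; clear -x2 y2; lia.
have nn : n != 2 by clear -n11; lia.
have I x y u v := @Bminus_relI n x y u v n11.
split; split.
- by apply: (I 3 6); clear -n11;
    [rewrite /precut_rel /switch /same_pair|cut_lia|cut_lia|].
- by apply: (I 4 6); clear -n11;
    [rewrite /precut_rel /switch /same_pair|cut_lia|cut_lia|].
- by apply: (I 1 6) (p _ _ a16 _ _) _ _ _; clear -n11 => //; cut_lia.
- by apply: (I 1 7) (p _ _ a17 _ _) _ _ _; clear -n11 => //; cut_lia.
- by apply: (I 0 7) (p _ _ a07 _ _) _ _ _; clear -n11 => //; cut_lia.
- by apply: (I 0 8) (p _ _ a08 _ _) _ _ _; clear -n11 => //; cut_lia.
- by apply: (I n 8) (p _ _ an8 nn _) _ _ _; clear -n11 => //; cut_lia.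
Qed.

Lemma Bplus_rel_mem n : 11 < n ->
  [/\ Bplus_rel n 0 3, Bplus_rel n 1 3, Bplus_rel n 3 (n - 1) &
    Bplus_rel n 4 (n - 1)] /\
  [/\ Bplus_rel n 4 (n - 2), Bplus_rel n 5 (n - 2), Bplus_rel n 5 (n - 3) &
    Bplus_rel n 6 (n - 3)].
Proof.
move=> n11; have [[a1 a2 _ a3 a4] [a5 a6 a7 a8]] := Aplus_rel_mem n11.
have I x y u v := @Bplus_relI n x y u v n11.
split; split.
- by apply: (I n 3 _ _ a1); clear -n11 => //; cut_lia.
- by apply: (I 0 3 _ _ a2); clear -n11 => //; cut_lia.
- by apply: (I 3 (n - 1) _ _ a3); clear -n11; try lia; cut_lia.
- by apply: (I 4 (n - 1) _ _ a4); clear -n11; try lia; cut_lia.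
- by apply: (I 4 (n - 2) _ _ a5); clear -n11; try lia; cut_lia.
- by apply: (I 5 (n - 2) _ _ a6); clear -n11; try lia; cut_lia.
- by apply: (I 5 (n - 3) _ _ a7); clear -n11; try lia; cut_lia.
- by apply: (I 6 (n - 3) _ _ a8); clear -n11; try lia; cut_lia.
Qed.

(** * Total weights of B_n^- and B_n^+ *)

Lemma phi_Bminus n : 11 < n -> triang n (Bminus_rel n) ->
  (phi n (weight n) (Bminus_rel n) <= - 4%:Z)%R.
Proof.
move=> n11 tB; have [gB _] := tB.
have [[b36 b46 b26 b27] [b17 b18 b08]] := Bminus_rel_mem n11.
have bd a : a.+1 < n -> Bminus_rel n a a.+1.
  by move=> an; apply: (boundary_edge tB); clear -an; lia.
(* These absences exclude every triangle of positive weight: one inside {0,1,2,3} uses 02 or 13, and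
   one on two vertices of {4,5,6} with apex beyond 6 uses an edge that crosses 36. *)
have n02 : Bminus_rel n 0 2 = false by apply/negP => h; apply: (graph_nx gB _ h b17).
have n13 : Bminus_rel n 1 3 = false by apply/negP => h; apply: (graph_nx gB _ h b26).
have n45 p x : 3 < p < 6 -> 6 < x -> Bminus_rel n p x = false.
  by move=> p3 x6; apply/negP => h; apply: (graph_nx gB _ b36 h); clear -p3 x6; cyc.
suff : (4%:Z <= phi n (fun a b c => - weight n a b c) (Bminus_rel n))%R.
  by rewrite phiN; clear; lia.
apply: (@phi_ge _ _ _ [:: (0, 1, 8); (1, 2, 7); (2, 3, 6); (4, 5, 6)]) => //.
- by rewrite /=; clear -n11; lia.
- move=> t; rewrite !inE => /or4P[]/eqP-> /=;
    by rewrite /tri ?b36 ?b46 ?b26 ?b27 ?b17 ?b18 ?b08 ?bd //; clear -n11; lia.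
move=> a b c /and5P[ab bc eab ebc eac].
rewrite !inE !xpair_eqE /weight; case: ifP => [c3|c3].
  have : [|| (a == 0) && (b == 2), (b == 1) && (c == 3), (a == 0) && (c == 2) |
    (a == 1) && (c == 3)] by clear -ab bc c3; lia.
  by case/or4P=> /andP[/eqP e1 /eqP e2]; subst; rewrite ?n02 ?n13 in eab ebc eac.
case: ifP => b3; first by clear -ab bc c3 b3; case: ifP; lia.
case: ifP => h; first by clear -ab bc c3 b3 h; lia.
case: ifP => c6; first by clear -ab bc c3 b3 h c6; lia.
case: ifP => h2; last by clear -ab bc c3 b3 h c6; lia.
by move: eac; rewrite n45 //; clear -ab bc b3 h c6; lia.
Qed.

Lemma phi_Bplus n : 11 < n -> triang n (Bplus_rel n) ->
  (4%:Z <= phi n (weight n) (Bplus_rel n))%R.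
Proof.
move=> n11 tB; have [gB _] := tB.
have [[b03 b13 b3n b4n] [b42 b52 b53 b63]] := Bplus_rel_mem n11.
have bd a : a.+1 < n -> Bplus_rel n a a.+1.
  by move=> an; apply: (boundary_edge tB); clear -an; lia.
(* Negative weights are excluded: the triangle 4,5,6 needs 46, and a triangle on two vertices of
   {0,1,2,3} with apex from 6 to 8 needs an edge crossing the one from 3 to [n - 1]. *)
have n46 : Bplus_rel n 4 6 = false.
  by apply/negP => h; apply: (graph_nx gB _ h b52); clear -n11; cyc.
have nx p x : p < 3 -> 3 < x -> x < n - 1 -> Bplus_rel n p x = false.
  move=> p3 x3 xn; apply/negP => h; apply: (graph_nx gB _ h b3n).
  by clear -p3 x3 xn; cyc.
apply: (@phi_ge _ _ _ [:: (0, 1, 3); (1, 2, 3); (4, 5, n - 2); (5, 6, n - 3)]) => //.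
- by rewrite /=; clear -n11; lia.
- move=> t; rewrite !inE => /or4P[]/eqP-> /=;
    by rewrite /tri ?b03 ?b13 ?b42 ?b52 ?b53 ?b63 ?bd //; clear -n11; lia.
move=> a b c /and5P[ab bc eab ebc eac].
rewrite !inE !xpair_eqE /weight.
case: ifP => [c3|c3]; first by clear -ab bc c3 n11; case: (_ || _); lia.
case: ifP => b3.
  case: ifP => h; last by clear -ab bc c3 b3 h n11; lia.
  by move: eac; rewrite nx //; clear -ab bc c3 b3 h n11; lia.
case: ifP => h; first by clear -ab bc c3 b3 h n11; lia.
case: ifP => c6; last by clear -ab bc c3 b3 h c6 n11; case: ifP; lia.
have [e1 e2] : a = 4 /\ c = 6 by clear -ab bc b3 h c6; lia.
by subst; rewrite n46 in eac.
Qed.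

(** * The contraction maps B_n into A_(n-5) *)

Lemma same_pairC x y a c : same_pair x y a c = same_pair y x a c.
Proof. by rewrite /same_pair orbC; congr orb; exact: andbC. Qed.

Lemma contr_cut n x : 11 < n -> x < n.+1 ->
  contr n (cut_map n x) =
  if (x <= 3) || (x == n) then 2 else if x <= 6 then 3 else wrap (n - 5) (x - 3).
Proof.
move=> n11 xn; case: ifP => [/orP[x3|/eqP->]|h].
- have -> : contr n (cut_map n x) = contr n 0.
    congr wrap; have : cut_map n x <= 3 by rewrite /cut_map /wrap; do ![case: ifP]; lia.
    by case: ifP; lia.
  by rewrite /contr /wrap /=; case: ifP; lia.
- have -> : cut_map n n = 0 by rewrite /cut_map /wrap; do ![case: ifP]; lia.
  by rewrite /contr /wrap /=; case: ifP; lia.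
have -> : cut_map n x = x by rewrite /cut_map /wrap; do ![case: ifP]; lia.
rewrite /contr /wrap; clear -n11 xn h; have [h1|h1] := boolP (x <= 3); first by lia.
by have [h2|h2] := boolP (x <= 6); case: ifP; lia.
Qed.

(** The composite is compared with the zigzag on [n - 1] vertices, six fewer than the original. Half
    the number of vertices drops by 3, and subtracting 3 from both ends turns the sums [n + 10] and
    [n + 11] into [n + 4] and [n + 5], which are again 5 and 6 modulo the number of vertices. *)
Lemma contr_cut_Aminus n X : 11 < n -> X < n + 5 ->
  contr n (cut_map n (Aminus_map n.+1 X)) =
  if (X <= 3) || (n + 2 <= X) then 2
  else Aminus_map (n - 5) (if X <= 6 then 3 else X - 3).
Proof.
move=> n11 Xn; rewrite contr_cut //; last first.
  by apply: (mono_lt (Aminus_map_monotone _)); lia.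
have : (n.+1 + 4)./2 = (n - 5 + 4)./2 + 3 by lia.
have : (n - 5 + 4)./2 * 2 <= n - 1 <= (n - 5 + 4)./2 * 2 + 1 by lia.
rewrite /Aminus_map => hH ->; move: (n - 5 + 4)./2 hH => H hH;
  rewrite /Aminus_pos /wrap.
by do ![case: ifP]; lia.
Qed.

(** Of the edges introduced by the three flips, 13 and 46 collapse and 36 goes to the boundary edge
    23. All other edges come from the large zigzag and are carried to the small one. *)
Lemma contr_Bminus n u v : 11 < n -> push n (contr n) (Bminus_rel n) u v ->
  Aminus_rel (n - 5) u v.
Proof.
move=> n11; have n6 : 6 < n - 5 by lia.
have sA := graph_sym (Aminus_rel_graph n6).
have map2 x : x <= 2 -> Aminus_map (n - 5) x = 2
  by rewrite /Aminus_map /Aminus_pos /wrap; do ![case: ifP]; lia.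
have spoke X Y : zig_rel (n.+1 + 4) X Y -> (X <= 3) || (n + 2 <= X) ->
    (3 < Y) && (Y < n + 2) -> ~~ ((X <= 2) && (3 < Y <= 6)) ->
    Aminus_rel (n - 5) 2 (Aminus_map (n - 5) (if Y <= 6 then 3 else Y - 3)).
  move=> XY hX hY ex.
  (* The vertices 0, 1, 2 all have label 2. The chosen one forms with the image of [Y] a small
     zigzag edge of sum 5 or 6, or the boundary edge at 0 when [Y = n + 1]. *)
  apply: (@Aminus_relI _ (if Y <= 7 then 2 else if Y == 8 then 1 else 0)
                 (if Y <= 6 then 3 else Y - 3)) => //.
  - move: XY; rewrite /zig_rel !inE; clear -n11 hX hY ex.
    by do ![case: ifP]; lia.
  - by apply: map2; clear; do ![case: ifP]; lia.
  - by rewrite /Aminus_map /Aminus_pos /wrap; clear -n11 hY; do ![case: ifP]; lia.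
case/pushP; first exact: Bminus_rel_graph.
move=> uv [s [t [st es et]]]; subst u v.
case/pushP: st; first exact: precut_graph.
move=> st [x [y [xy es et]]]; subst s t.
have e1 : contr n (cut_map n 1) = 2 by rewrite contr_cut //; clear -n11; lia.
have e3 : contr n (cut_map n 3) = 2 by rewrite contr_cut //; clear -n11; lia.
have e4 : contr n (cut_map n 4) = 3 by rewrite contr_cut; [case: ifP| |]; clear -n11;
  lia.
have e6 : contr n (cut_map n 6) = 3 by rewrite contr_cut; [case: ifP| |]; clear -n11;
  lia.
have [h31|n31] := boolP (same_pair x y 3 1).
  by case: uv; case/orP: h31 => /andP[/eqP-> /eqP->]; rewrite ?e1 ?e3.
have [h46|n46] := boolP (same_pair x y 4 6).
  by case: uv; case/orP: h46 => /andP[/eqP-> /eqP->]; rewrite ?e4 ?e6.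
have [h36|n36] := boolP (same_pair x y 3 6).
  have A23 : Aminus_rel (n - 5) 2 3 by apply: Aminus_rel_boundary; clear -n11; lia.
  by case/orP: h36 => /andP[/eqP-> /eqP->]; rewrite e3 e6 //; exact: sA.
have : Aminus_rel n.+1 x y && [&& ~~ same_pair x y 2 5, ~~ same_pair x y 2 4 &
  ~~ same_pair x y 2 6].
  move: xy; rewrite /precut_rel /switch (negbTE n31) (negbTE n36) (negbTE n46) !orFb.
  by case/andP=> /andP[/andP[-> ->] ->] ->.
case/and4P=> xy' s1 s2 s3; case/pushP: xy'; first by apply: zig_rel_graph; lia.
move=> xy' [X [Y [XY ex ey]]]; subst x y.
have [Xn Yn] : X < n + 5 /\ Y < n + 5 by case/and4P: XY; clear; lia.
have exc Z W : W < n + 5 -> ~~ same_pair (Aminus_map n.+1 Z) (Aminus_map n.+1 W) 2 5 ->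
    ~~ same_pair (Aminus_map n.+1 Z) (Aminus_map n.+1 W) 2 4 ->
    ~~ same_pair (Aminus_map n.+1 Z) (Aminus_map n.+1 W) 2 6 ->
      ~~ ((Z <= 2) && (3 < W <= 6)).
  move=> Wn q1 q2 q3; apply/negP => /andP[Z2 W6].
  have hZ : Aminus_map n.+1 Z = 2 by rewrite /Aminus_map /Aminus_pos /wrap;
    clear -Z2 n11; do ![case: ifP]; lia.
  have hW : Aminus_map n.+1 W = W by rewrite /Aminus_map /Aminus_pos /wrap;
    clear -W6 n11; do ![case: ifP]; lia.
  by move: q1 q2 q3; rewrite hZ hW; clear -W6; cyc.
have exXY := exc _ _ Yn s1 s2 s3.
have exYX : ~~ ((Y <= 2) && (3 < X <= 6)).
  by apply: exc => //; rewrite same_pairC.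
move: uv; rewrite !contr_cut_Aminus //.
have [hX|hX] := boolP ((X <= 3) || (n + 2 <= X));
  have [hY|hY] := boolP ((Y <= 3) || (n + 2 <= Y)) => // uv.
- by apply: (spoke X) => //; clear -hY; lia.
- have zG : graph (n.+1 + 4) (zig_rel (n.+1 + 4)) by apply: zig_rel_graph; lia.
  by apply: sA; apply: (spoke Y) => //; [exact: (graph_sym zG)|clear -hX; lia].
apply: (Aminus_relI _ _ erefl erefl uv) => //.
have [X6|X6] := boolP (X <= 6); have [Y6|Y6] := boolP (Y <= 6); move: XY uv;
  rewrite ?X6 ?Y6 //.
all: by rewrite /zig_rel !inE ?(negbTE X6) ?(negbTE Y6); clear -n11 hX hY X6 Y6; lia.
Qed.

(** After 0, ..., 6 are merged into 3, the composite passes through the small zigzag by subtracting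
    3 modulo [n - 1]; this accounts for the third case, where [X - 3] has gone past the end. *)
Lemma contr_cut_Aplus n X : 11 < n -> X < n + 5 ->
  contr n (cut_map n (Aplus_map n.+1 X)) =
  Aplus_map (n - 5) (if X <= 6 then 3 else if X < n + 2 then X - 3 else X - n - 2).
Proof.
move=> n11 Xn; rewrite contr_cut //; last first.
  by apply: (mono_lt (Aplus_map_monotone _)); lia.
have : (n.+1 + 4)./2 = (n - 5 + 4)./2 + 3 by lia.
have : (n - 5 + 4)./2 * 2 <= n - 1 <= (n - 5 + 4)./2 * 2 + 1 by lia.
rewrite /Aplus_map => hH ->; move: (n - 5 + 4)./2 hH => H hH.
have [X6|X6] := boolP (X <= 6).
  have -> : wrap (n - 5) (Aplus_pos (n - 5) H 3) = 2 by rewrite /Aplus_pos /wrap /=;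
    case: ifP; lia.
  rewrite /Aplus_pos X6 /wrap; have [X3|X3] := boolP (X <= 3).
    by do ![case: ifP]; lia.
  by do ![case: ifP]; lia.
rewrite [Aplus_pos n.+1]/Aplus_pos (negbTE X6); have -> : (X <= 3) = false by lia.
have [Xl|Xl] := boolP (X < n + 2).
  have e1 : (X - 3 <= 3) = false by lia.
  rewrite /Aplus_pos e1 /wrap; clear e1.
  by do ![case: ifP] => *; lia.
have e1 : X - n - 2 <= 3 by lia.
by rewrite /Aplus_pos e1 /wrap; clear e1; do ![case: ifP] => *; lia.
Qed.

Lemma contr_Bplus n u v : 11 < n -> push n (contr n) (Bplus_rel n) u v ->
  Aplus_rel (n - 5) u v.
Proof.
move=> n11; have n6 : 6 < n - 5 by lia.
case/pushP; first exact: Bplus_rel_graph.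
move=> uv [s [t [st es et]]]; subst u v.
case/pushP: st; first by apply: Aplus_rel_graph; lia.
move=> st [x [y [xy es et]]]; subst s t.
case/pushP: xy; first by apply: zig_rel_graph; lia.
move=> xy' [X [Y [XY ex ey]]]; subst x y.
have [Xn Yn] : X < n + 5 /\ Y < n + 5 by case/and4P: XY; clear; lia.
move: uv; rewrite !contr_cut_Aplus // => uv.
apply: (Aplus_relI _ _ erefl erefl uv) => //; move: XY uv; rewrite /zig_rel !inE.
have [X6|X6] := boolP (X <= 6); have [Y6|Y6] := boolP (Y <= 6) => // XY _.
- by clear -n11 X6 Y6 XY; have [h|h] := boolP (Y < n + 2); lia.
- by clear -n11 X6 Y6 XY; have [h|h] := boolP (X < n + 2); lia.
clear -n11 X6 Y6 XY; case/and4P: XY => Xn Yn nXY XY.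
have {}XY : [|| X.+1 == Y, Y.+1 == X, X + Y == n + 10 | X + Y == n + 11] by lia.
by have [h|h] := boolP (X < n + 2); have [h'|h'] := boolP (Y < n + 2); lia.
Qed.

(** * Relations and sets of edges *)

(** The bounds keep numbers from [n] on from being read modulo [n]. *)
Definition rel_of (n : nat) (T : {set {set 'Z_n}}) : rel nat := fun x y =>
  [&& x < n, y < n & [set (x%:R)%R; (y%:R)%R] \in T].

Definition set_of (n : nat) (E : rel nat) : {set {set 'Z_n}} :=
  [set e : {set 'Z_n} | [exists a : 'Z_n, exists b : 'Z_n, E a b && (e == [set a; b])]].

Lemma set2_eqP (V : finType) (x y a c : V) : [set x; y] = [set a; c] ->
  (x = a /\ y = c) \/ (x = c /\ y = a).
Proof.
move=> h; have := set21 x y; have := set22 x y; rewrite h => /set2P hy /set2P hx.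
have := set21 a c; have := set22 a c; rewrite -h => /set2P hc /set2P ha.
by case: hx; case: hy; case: ha; case: hc => *; subst; auto.
Qed.

(** Measured by clockwise distance from [r], the rotated polygon reads 0, 1, 2, ...; this turns
    [clockwise], which speaks of subsequences of rotations, into inequalities. *)
Lemma map_rot_iota r k : r < k ->
  map (fun x => if r <= x then x - r else x + k - r) (rot r (iota 0 k)) = iota 0 k.
Proof.
move=> rk; rewrite /rot drop_iota take_iota map_cat add0n (minn_idPl (ltnW rk)).
have -> : iota 0 k = iota 0 (k - r) ++ iota (k - r) r by rewrite -iotaD subnK // ltnW.
congr (_ ++ _).
  rewrite -[X in iota X _](addn0 r) iotaDl -map_comp -[RHS]map_id; apply/eq_in_map => x.
  by rewrite mem_iota /=; case: ifP; lia.
rewrite -[in RHS](addn0 (k - r)) iotaDl; apply/eq_in_map => x.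
by rewrite mem_iota /=; case: ifP; lia.
Qed.

(** * Clockwise successors in a polygon listed in increasing order *)

Section SortedCycle.

Variables (k : nat) (p : seq 'I_k).
Hypothesis sp : sorted ltn (map (@nat_of_ord k) p).

Lemma sorted_index (a b : 'I_k) : a \in p -> b \in p ->
  (index a p < index b p) = (a < b).
Proof.
have ilt (c d : 'I_k) : c \in p -> d \in p -> index c p < index d p -> c < d.
  move=> cp dp lt; have := sorted_ltn_nth ltn_trans (nat_of_ord a) sp.
  move=> /(_ (index c p) (index d p)); rewrite !inE !size_map !index_mem =>
    /(_ cp dp lt).
  by rewrite !(nth_map a) ?index_mem // !nth_index.
move=> ap bp; apply/idP/idP; first exact: ilt.
apply: contraTT; rewrite -!leqNgt leq_eqVlt => /orP[/eqP e|];
  last by move/ilt => /(_ bp ap)/ltnW.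
suff -> : a = b by [].
by rewrite -(nth_index a ap) -(nth_index a bp) e.
Qed.

Lemma nextE (x0 a : 'I_k) : a \in p -> next p a =
  if (index a p).+1 < size p then nth x0 p (index a p).+1 else nth x0 p 0.
Proof.
move=> ap; rewrite next_nth ap; case: (p) ap => // y q ap; rewrite [size _]/= ltnS.
case: ltnP => h; last by rewrite nth_default.
exact: set_nth_default.
Qed.

Lemma next_succ (a b : 'I_k) : a \in p -> b \in p -> a < b ->
  (forall c, c \in p -> ~~ (a < c < b)) -> next p a = b.
Proof.
move=> ap bp ab nb; have lt : index a p < index b p by rewrite sorted_index.
have sz : (index a p).+1 < size p by apply: leq_ltn_trans lt _; rewrite index_mem.
rewrite (nextE a) // sz; set c := nth _ _ _.
have cp : c \in p by exact: mem_nth.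
have up : uniq p.
  by have := sorted_uniq ltn_trans ltnn sp; rewrite map_inj_uniq //; exact: val_inj.
have ic : index c p = (index a p).+1 by rewrite index_uniq.
have ac : a < c by rewrite -sorted_index // ic.
have := nb c cp; rewrite ac /= -leqNgt leq_eqVlt => /orP[/eqP /val_inj //|].
by rewrite -sorted_index // ic ltnS leqNgt lt.
Qed.

Lemma next_wrap (a b : 'I_k) : a \in p -> b \in p ->
  (forall c, c \in p -> b <= c <= a) -> next p a = b.
Proof.
move=> ap bp ext; rewrite (nextE a) //.
have up : uniq p.
  by have := sorted_uniq ltn_trans ltnn sp; rewrite map_inj_uniq //; exact: val_inj.
case: ifP => sz.
  have cp : nth a p (index a p).+1 \in p by exact: mem_nth.
  have /andP[_] := ext _ cp; rewrite leqNgt -sorted_index // index_uniq //.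
  by rewrite ltnSn.
have p0 : 0 < size p by case: (p) ap.
have cp : nth a p 0 \in p by exact: mem_nth.
have /andP[bc _] := ext _ cp; apply/val_inj/eqP; rewrite /= eqn_leq bc andbT leqNgt.
by rewrite -sorted_index // index_uniq // ltn0.
Qed.

End SortedCycle.

Section Bridge.

Variable n : nat.
Hypothesis n1 : 1 < n.
Local Notation p := (polygon n).
Implicit Types (a b c d : 'Z_n) (T U : {set {set 'Z_n}}) (E : rel nat).

Lemma Zval x : x < n -> nat_of_ord (x%:R%R : 'Z_n) = x.
Proof. by move=> xn; rewrite val_Zp_nat // modn_small. Qed.

Lemma Zlt a : a < n.
Proof. by rewrite -[X in _ < X](Zp_cast n1) ltn_ord. Qed.

Lemma map_val_polygon : map (@nat_of_ord _) p = iota 0 n.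
Proof. by rewrite /polygon -[X in iota _ X](Zp_cast n1) -val_enum_ord. Qed.

Lemma size_polygon : size p = n.
Proof. by rewrite -(size_map (@nat_of_ord _)) map_val_polygon size_iota. Qed.

Lemma clockwise_polygon a b c d : clockwise p [:: a; b; c; d] = cyc4 a b c d.
Proof.
apply/idP/idP => [/hasP[r]|cy].
  rewrite mem_iota add0n size_polygon => /andP[_ rn] sub.
  have {}sub := map_subseq (@nat_of_ord _) sub.
  move: sub; rewrite map_rot /= map_val_polygon => sub.
  have := map_subseq (fun x => if r <= x then x - r else x + n - r) sub.
  rewrite map_rot_iota // => /(subseq_sorted ltn_trans) /(_ (iota_ltn_sorted 0 n)) /=.
  have := Zlt a; have := Zlt b; have := Zlt c; have := Zlt d; rewrite andbT.
  by clear -rn; do ![case: ifP] => *; cyc.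
apply/hasP; exists (nat_of_ord a); first by rewrite mem_iota add0n size_polygon Zlt.
pose f (x : 'Z_n) := if a <= x then x - a else x + n - a.
have fi : injective f.
  move=> x y; have := Zlt x; have := Zlt y; have := Zlt a.
  by rewrite /f => h1 h2 h3 h; apply: val_inj => /=; move: h; do ![case: ifP]; lia.
pose R := relpre f ltn.
have Rt : transitive R by move=> x y z; exact: ltn_trans.
have Ri : irreflexive R by move=> x; exact: ltnn.
suff -> : [:: a; b; c; d] = [seq x <- rot a p | x \in [:: a; b; c; d]].
  exact: filter_subseq.
apply: (irr_sorted_eq Rt Ri).
- have := Zlt a; have := Zlt b; have := Zlt c; have := Zlt d; move: cy.
  by rewrite /R /= /f; do ![case: ifP]; cyc.
- apply: (sorted_filter Rt); rewrite -sorted_map.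
  suff -> : map f (rot a p) = iota 0 n by exact: iota_ltn_sorted.
  by rewrite -(map_rot_iota (Zlt a)) -map_val_polygon -map_rot -map_comp.
- by move=> x; rewrite mem_filter mem_rot mem_enum andbT.
Qed.

Lemma rel_ofE T a b : rel_of T a b = ([set a; b] \in T).
Proof. by rewrite /rel_of !Zlt !natr_Zp. Qed.

Lemma edgesP e : reflect (exists a b, a != b /\ e = [set a; b]) (e \in edges p).
Proof.
rewrite inE; apply: (iffP andP) => [[/cards2P[a [b [ab ->]]] _]|[a [b [ab ->]]]].
  by exists a, b.
by split; [rewrite cards2 ab|apply/subsetP => x _; exact: mem_enum].
Qed.

Lemma crossP e f : reflect (exists a b c d, [/\ cyc4 a b c d, e = [set a;
  c] & f = [set b; d]])
  (cross p e f).
Proof.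
apply: (iffP existsP) =>
  [[a /existsP[b /existsP[c /existsP[d /and3P[cy /eqP-> /eqP->]]]]]|].
  by exists a, b, c, d; split=> //; rewrite -clockwise_polygon.
case=> a [b [c [d [cy -> ->]]]]; exists a; apply/existsP; exists b; apply/existsP;
  exists c.
by apply/existsP; exists d; rewrite clockwise_polygon cy !eqxx.
Qed.

Lemma noncrossing_graph T : noncrossing p T -> graph n (rel_of T).
Proof.
case/andP=> /subsetP sT /forallP nx; split.
- by move=> x y /and3P[xn yn xy]; rewrite /rel_of xn yn setUC.
- by move=> x y /and3P[].
- move=> x y /and3P[_ _ /sT /edgesP[a [b [ab e]]]] xy; subst y.
  by case/set2_eqP: e => -[e1 e2]; case/eqP: ab; rewrite -e1 -e2.
- move=> a b c d cy /and3P[an cn ac] /and3P[bn dn bd].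
  have := nx [set (a%:R)%R; (c%:R)%R]; rewrite ac /= => /forallP/(_ [set (b%:R)%R;
    (d%:R)%R]).
  rewrite bd /= => /negP; apply; apply/crossP.
  by exists (a%:R)%R, (b%:R)%R, (c%:R)%R, (d%:R)%R; split=> //; rewrite !Zval.
Qed.

Lemma in_set_of E a b : graph n E -> ([set a; b] \in set_of n E) = E a b.
Proof.
move=> gE; rewrite inE; apply/existsP/idP => [[x /existsP[y /andP[xy /eqP e]]]|ab].
  by case/set2_eqP: e => -[-> ->] //; exact: (graph_sym gE).
by exists a; apply/existsP; exists b; rewrite ab eqxx.
Qed.

Lemma rel_of_set_of E : graph n E -> rel_of (set_of n E) =2 E.
Proof.
move=> gE x y; rewrite /rel_of; apply/and3P/idP => [[xn yn]|xy].
  by rewrite in_set_of // !Zval.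
have xn := graph_lt gE xy; have yn := graph_ltr gE xy.
by split=> //; rewrite in_set_of // !Zval.
Qed.

Lemma set_of_rel_of T : T \subset edges p -> set_of n (rel_of T) = T.
Proof.
move=> /subsetP sT; apply/setP => e; rewrite inE; apply/existsP/idP.
  by case=> a /existsP[b /andP[ab /eqP->]]; rewrite -rel_ofE.
move=> eT; have /edgesP[a [b [_ ee]]] := sT _ eT.
by exists a; apply/existsP; exists b; rewrite rel_ofE -ee eT eqxx.
Qed.

Lemma eq_set_of E E' : E =2 E' -> set_of n E = set_of n E'.
Proof.
move=> EE; apply/setP => e; rewrite !inE.
by apply/existsP/existsP => -[a /existsP[b h]]; exists a; apply/existsP; exists b;
  rewrite ?EE // -EE.
Qed.

Lemma set_of_edges E : graph n E -> set_of n E \subset edges p.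
Proof.
move=> gE; apply/subsetP => e; rewrite inE => /existsP[a /existsP[b /andP[ab /eqP->]]].
by apply/edgesP; exists a, b; split=> //; apply/eqP => ee; apply: (graph_neq gE ab);
  rewrite ee.
Qed.

Lemma set_of_noncrossing E : graph n E -> noncrossing p (set_of n E).
Proof.
move=> gE; rewrite /noncrossing set_of_edges //=.
apply/forallP => e; apply/implyP => eE; apply/forallP => f; apply/implyP => fE.
apply/negP => /crossP[a [b [c [d [cy ee ef]]]]]; subst e f.
by rewrite !in_set_of // in eE fE; exact: (graph_nx gE cy eE fE).
Qed.

Lemma triangulation_triang T : triangulation p T -> triang n (rel_of T).
Proof.
case/maxsetP=> ncT maxT; split; first exact: noncrossing_graph.
have gT := noncrossing_graph ncT.
have /andP[sT _] := ncT.
move=> x y xn yn xy h.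
pose E u v := same_pair u v x y || rel_of T u v.
have gE : graph n E.
  split.
  - move=> u v /orP[e|/(graph_sym gT) uv]; last by rewrite /E uv orbT.
    by apply/orP; left; clear -e; cyc.
  - by move=> u v /orP[e|/(graph_lt gT)//]; clear -e xn yn; cyc.
  - by move=> u v /orP[e|/(graph_neq gT)//]; clear -e xy; cyc.
  - move=> a b c d cy /orP[e|ac] /orP[e'|bd].
    + by clear -cy e e'; cyc.
    + case/orP: e => /andP[/eqP ex /eqP ey]; subst; first exact: (h b d).
      by apply: (h d b); [clear -cy; cyc|exact: (graph_sym gT)].
    + case/orP: e' => /andP[/eqP ex /eqP ey]; subst.
        by apply: (h c a); [clear -cy; cyc|exact: (graph_sym gT)].
      by apply: (h a c) => //; clear -cy; cyc.
    + exact: (graph_nx gT cy ac bd).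
have sTE : T \subset set_of n E.
  rewrite -{1}(set_of_rel_of sT); apply/subsetP => e; rewrite !inE.
  case/existsP=> a /existsP[b /andP[ab ee]]; apply/existsP; exists a; apply/existsP;
    exists b.
  by rewrite /E ab orbT.
have eT := maxT _ (set_of_noncrossing gE) sTE.
by rewrite -eT rel_of_set_of // /E /same_pair !eqxx.
Qed.

Lemma triang_triangulation E : triang n E -> triangulation p (set_of n E).
Proof.
case=> gE mE; apply/maxsetP; split; first exact: set_of_noncrossing.
move=> B ncB sEB; apply/eqP; rewrite eqEsubset sEB andbT; apply/subsetP => e eB.
have gB := noncrossing_graph ncB; have /andP[/subsetP sB _] := ncB.
have /edgesP[a [b [ab ee]]] := sB _ eB; subst e; rewrite in_set_of //.
apply: mE; rewrite ?Zlt //; first by move=> e; case/eqP: ab; exact: val_inj.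
move=> c d cy cd; rewrite -rel_ofE in eB; apply: (graph_nx gB cy eB).
have cn := graph_lt gE cd; have dn := graph_ltr gE cd.
rewrite /rel_of cn dn /=; apply: (subsetP sEB); rewrite in_set_of //.
by rewrite !Zval.
Qed.

(** The choice made by [flip] is determined: the other two corners of any admissible quadrilateral
    are common neighbours of [x] and [z], hence are [y] and [t] by [common_neighbour]. *)
Lemma flipE T (x y z t : nat) E' : noncrossing p T -> flip_at (rel_of T) E' x y z t ->
  flip p T [set (x%:R)%R; (z%:R)%R] = set_of n E'.
Proof.
move=> ncT fl; have gT := noncrossing_graph ncT; have gE' := flip_graph gT fl.
have [cy xz xy yz zt tx EE] := fl.
have xn := graph_lt gT xy; have yn := graph_lt gT yz.
have zn := graph_lt gT zt; have tn := graph_lt gT tx.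
have /andP[sT _] := ncT.
have eU : [set (y%:R)%R; (t%:R)%R] |: (T :\ [set (x%:R)%R; (z%:R)%R]) = set_of n E'.
  apply/setP => e; rewrite !inE; apply/orP/existsP =>
    [h|[a /existsP[b /andP[ab /eqP->]]]].
    have [a [b [ee]]] : exists a b, e = [set a; b] /\ E' a b.
      case: h => [/eqP->|/andP[ne eT]].
        exists (y%:R)%R, (t%:R)%R; split=> //.
        by rewrite EE !Zval // /same_pair !eqxx.
      have /edgesP[a [b [ab ee]]] := subsetP sT _ eT; subst e.
      exists a, b; split=> //; rewrite EE rel_ofE eT /=; apply/orP; right.
      apply/negP => /orP[]/andP[/eqP e1 /eqP e2]; case/eqP: ne;
        rewrite -e1 -e2 !natr_Zp //.
      by rewrite setUC.
    by move=> ab; exists a; apply/existsP; exists b; rewrite ab ee eqxx.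
  move: ab; rewrite EE => /orP[/orP[]/andP[/eqP e1 /eqP e2]|/andP[ab nxz]].
  - by left; rewrite -e1 -e2 !natr_Zp.
  - by left; rewrite -e1 -e2 !natr_Zp setUC.
  right; rewrite -rel_ofE ab andbT; apply/eqP => /set2_eqP eab.
  by case/negP: nxz; case: eab => -[-> ->]; rewrite !Zval // /same_pair !eqxx ?orbT.
rewrite -eU /flip; case: pickP => [f|nf]; last first.
  case/negP: (negbT (nf [set (y%:R)%R; (t%:R)%R])); apply/existsP; exists (x%:R)%R;
    apply/existsP; exists (y%:R)%R.
  apply/existsP; exists (z%:R)%R; apply/existsP; exists (t%:R)%R.
  rewrite clockwise_polygon !Zval // cy !eqxx /=.
  by move: xy yz zt tx => /and3P[_ _ ->] /and3P[_ _ ->] /and3P[_ _ ->] /and3P[_ _ ->].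
case/existsP=> a /existsP[b /existsP[c /existsP[d]]].
case/and5P=> cw /eqP ac /eqP -> ab /and3P[bc cd da].
rewrite clockwise_polygon in cw; rewrite -!rel_ofE in ab bc cd da.
have cn := common_neighbour gT cy xy yz zt tx.
have [hb hd] : (nat_of_ord b = y \/ nat_of_ord b = t) /\ (nat_of_ord d = y \/
  nat_of_ord d = t).
  have ba := graph_sym gT ab; have dc := graph_sym gT cd.
  by case/set2_eqP: ac => -[e1 e2]; subst a c; rewrite !Zval // in ab bc cd da ba dc *;
    split; apply: cn.
have nbd : nat_of_ord b <> nat_of_ord d by clear -cw; cyc.
congr (_ |: _); rewrite -(natr_Zp b) -(natr_Zp d).
by case: hb nbd => ->; case: hd => -> // _; rewrite setUC.
Qed.

Lemma sorted_polygon : sorted ltn (map (@nat_of_ord _) p).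
Proof. by rewrite map_val_polygon iota_ltn_sorted. Qed.

Lemma mem_polygon a : a \in p.
Proof. exact: mem_enum. Qed.

Lemma next_polygon a : nat_of_ord (next p a) = if a.+1 < n then a.+1 else 0.
Proof.
case: ifP => an.
  rewrite (@next_succ _ _ sorted_polygon a ((a.+1)%:R)%R) ?mem_polygon ?Zval //.
  by move=> c _; rewrite ?Zval //; lia.
rewrite (@next_wrap _ _ sorted_polygon a (0%:R)%R) ?mem_polygon ?Zval //; try lia.
by move=> c _; rewrite ?Zval; have := Zlt c; have := Zlt a; lia.
Qed.

Lemma boundaryP a b : [set a; b] \in boundary p -> (b = next p a) \/ (a = next p b).
Proof. by case/imsetP=> x _ /set2_eqP[] [-> ->]; [left|right]. Qed.

(** The alternative [U = T] absorbs the default value of [flip]. Such a step changes neither the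
    contraction nor the weight. *)
Lemma flip_rel_step T U : flip_rel p T U ->
  triangulation p T /\
  (U = T \/ exists E x y z t, flip_at (rel_of T) E x y z t /\ U = set_of n E).
Proof.
case/andP=> tT /existsP[e /andP[/setDP[eT _] /eqP->]]; split=> //.
have /maxsetP[ncT _] := tT; have gT := noncrossing_graph ncT.
case E : [pick f | quad_diagonals p T e f] => [f|]; last by left; rewrite /flip E.
move: E; case: pickP => [g|//]; case/existsP=> a /existsP[b /existsP[c /existsP[d]]].
case/and5P=> cw /eqP ee /eqP ef ab /and3P[bc cd da] _; subst e; right.
rewrite clockwise_polygon in cw; rewrite -!rel_ofE in eT ab bc cd da.
have fl : flip_at (rel_of T) (switch (rel_of T) a b c d) a b c d by split.
exists (switch (rel_of T) a b c d), a, b, c, d; split=> //.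
by have := flipE ncT fl; rewrite !natr_Zp.
Qed.

Lemma flip_rel_set_of E E' x y z t : triang n E -> flip_at E E' x y z t ->
  flip_rel p (set_of n E) (set_of n E').
Proof.
move=> tE fl; have [gE _] := tE; have [cy xz xy yz zt tx EE] := fl.
rewrite /flip_rel triang_triangulation //=.
have xn := graph_lt gE xy; have zn := graph_lt gE zt.
have yn := graph_lt gE yz; have tn := graph_lt gE tx.
apply/existsP; exists [set (x%:R)%R; (z%:R)%R]; apply/andP; split.
  rewrite inE in_set_of // !Zval // xz andbT; apply/negP => /boundaryP[] e;
    have := congr1 (@nat_of_ord _) e; rewrite next_polygon !Zval //;
    by clear -cy xn yn zn tn; case: ifP; cyc.
rewrite eq_sym (@flipE _ x y z t E') //; first exact: set_of_noncrossing.
have rE := rel_of_set_of gE.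
by split; rewrite ?rE // => u v; rewrite rE EE.
Qed.

End Bridge.

(** * Deletions and relabelings as images of edge sets *)

Section PushSet.

Variables V W : finType.
Implicit Types (g : V -> W) (T : {set {set V}}).

Definition pairs (V : finType) (T : {set {set V}}) : Prop :=
  forall e, e \in T -> exists x y, x != y /\ e = [set x; y].

Definition push_set g T : {set {set W}} :=
  [set e : {set W} | [exists x, exists y,
     [&& [set x; y] \in T, g x != g y & e == [set g x; g y]]]].

Lemma push_setP g T e :
  reflect (exists x y, [/\ [set x; y] \in T, g x != g y & e = [set g x; g y]])
          (e \in push_set g T).
Proof.
rewrite inE; apply: (iffP existsP) => [[x /existsP[y /and3P[xy gxy /eqP->]]]|].
  by exists x, y.
by case=> x [y [xy gxy ->]]; exists x; apply/existsP; exists y; rewrite xy gxy eqxx.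
Qed.

Lemma push_set_pairs g T : pairs (push_set g T).
Proof. by move=> e /push_setP[x [y [_ gxy ->]]]; exists (g x), (g y). Qed.

Lemma imset2E g x y : [set g z | z in [set x; y]] = [set g x; g y].
Proof. by rewrite imsetU1 imset_set1. Qed.

End PushSet.

Lemma push_set_id (V : finType) (g : V -> V) (T : {set {set V}}) : pairs T -> g =1 id ->
  push_set g T = T.
Proof.
move=> pT gid; apply/setP => e; apply/push_setP/idP => [[x [y [xy _ ->]]]|eT].
  by rewrite !gid.
by have [x [y [nxy ee]]] := pT _ eT; exists x, y; rewrite !gid -ee.
Qed.

Lemma push_set_comp (U V W : finType) (g : V -> W) (h : U -> V) (T : {set {set U}}) :
  push_set g (push_set h T) = push_set (g \o h) T.
Proof.
apply/setP => e; apply/push_setP/push_setP.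
  case=> x [y [/push_setP[u [v [uv huv /set2_eqP exy]]] gxy ->]].
  case: exy gxy => -[-> ->] gxy; first by exists u, v.
  by exists u, v; split=> //=; [rewrite eq_sym|rewrite setUC].
case=> u [v [uv guv ->]]; exists (h u), (h v); split=> //.
apply/push_setP; exists u, v; split=> //; apply: contraNneq guv => /= ->.
exact: eqxx.
Qed.

Definition delmap (V : finType) (p : seq V) (a x : V) : V :=
  if x == a then next p a else x.

Fixpoint delmaps (V : finType) (s p : seq V) (x : V) : V :=
  if s is a :: s' then delmaps s' (rem a p) (delmap p a x) else x.

(** The only pair of distinct vertices identified by sending [a] to its successor is the edge
    between them, exactly the one that [deletion] discards beforehand. *)
Lemma deletionE (V : finType) (p : seq V) a (T : {set {set V}}) : pairs T ->
  deletion p a T = push_set (delmap p a) T.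
Proof.
move=> pT; apply/setP => e; apply/imsetP/push_setP.
  case=> f /setD1P[nf fT ->]; have [x [y [nxy ef]]] := pT _ fT; subst f.
  exists x, y; split=> //; last exact: imset2E.
  apply: contra nf; rewrite /delmap.
  have [ex|nx] := eqVneq x a; have [ey|ny] := eqVneq y a.
  - by rewrite ex ey eqxx in nxy.
  - by move/eqP=> <-; rewrite ex.
  - by move/eqP=> ->; rewrite ey setUC.
  - by rewrite (negPf nxy).
case=> x [y [xy gxy ->]]; exists [set x; y]; last by rewrite imset2E.
rewrite !inE xy andbT; apply: contra gxy => /eqP/set2_eqP[] [-> ->].
  by rewrite /delmap eqxx if_same.
by rewrite /delmap eqxx if_same.
Qed.

Lemma deletionsE (V : finType) (s p : seq V) (T : {set {set V}}) : pairs T ->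
  deletions s p T = (foldl (fun q a => rem a q) p s, push_set (delmaps s p) T).
Proof.
elim: s p T => [|a s IHs] p T pT /=; first by rewrite push_set_id.
by rewrite IHs deletionE //; [rewrite push_set_comp|exact: push_set_pairs].
Qed.

Lemma relabelE (V : finType) (n : nat) (p : seq V) v (l : 'Z_n) (T : {set {set V}}) :
  pairs T ->
  (forall x y, [set x; y] \in T -> x != y -> label p v l x != label p v l y) ->
  relabel p v l T = push_set (label p v l) T.
Proof.
move=> pT inj; apply/setP => e; apply/imsetP/push_setP.
  case=> f fT ->; have [x [y [nxy ef]]] := pT _ fT; subst f.
  by exists x, y; split=> //; [exact: inj|exact: imset2E].
by case=> x [y [xy _ ->]]; exists [set x; y] => //; rewrite imset2E.
Qed.

Lemma set_of_pairs n E : graph n E -> pairs (set_of n E).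
Proof. by move=> gE e /(subsetP (set_of_edges gE))/edgesP. Qed.

Lemma push_set_of N n (E : rel nat) (g : 'Z_N -> 'Z_n) (h : nat -> nat) : 1 < N ->
  graph N E -> graph n (push N h E) -> (forall x, nat_of_ord (g x) = h x) ->
  push_set g (set_of N E) = set_of n (push N h E).
Proof.
move=> N1 gE gP gh; apply/setP => e; apply/push_setP/idP.
  case=> x [y [xy gxy ->]]; rewrite in_set_of // -?gh //; rewrite in_set_of // in xy.
  by rewrite !gh; apply: push_edge => //; rewrite -!gh => ee; case/eqP: gxy;
    exact: val_inj.
rewrite inE => /existsP[a /existsP[b /andP[/pushP[]// nab [x [y [xy ea eb]]] /eqP->]]].
have xn := graph_lt gE xy; have yn := graph_ltr gE xy.
exists (x%:R)%R, (y%:R)%R; split.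
- by rewrite in_set_of // !Zval.
- by apply/eqP => ee; apply: nab; rewrite -ea -eb -(Zval N1 xn) -(Zval N1 yn) -!gh ee.
- by congr [set _; _]; apply: val_inj; rewrite /= gh Zval.
Qed.

(** * The zigzag as the pairs with sum 5 or 6 *)

Section RingIdentities.
Local Open Scope ring_scope.
Variables (R : comNzRingType) (k : R).
Lemma odd_sum : 2 - k + (4 + k) = 6%:R. Proof. by ring. Qed.
Lemma even_sum : 1 - k + (4 + k) = 5%:R. Proof. by ring. Qed.
Lemma odd_diff : 4 + k - (2 - k) = 2%:R + 2%:R * k. Proof. by ring. Qed.
Lemma even_diff : 4 + k - (1 - k) = 3%:R + 2%:R * k. Proof. by ring. Qed.
Lemma odd_end : 6%:R - (4 + k) = 2 - k. Proof. by ring. Qed.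
Lemma even_end : 5%:R - (4 + k) = 1 - k. Proof. by ring. Qed.
End RingIdentities.

Lemma zigzag_set_of N : 10 < N -> zigzag N = set_of N (zig_rel N).
Proof.
move=> N10; have N1 : 1 < N by lia.
have NR : (N%:R = 0 :> 'Z_N)%R by exact: pchar_Zp.
have sumE (a b : 'Z_N) k : k < N -> (a + b = k%:R)%R -> a + b = k \/ a + b = N + k.
  move=> kN e; have : nat_of_ord (a + b)%R = k by rewrite e Zval.
  rewrite [LHS]/= [X in _ %% X](Zp_cast N1).
  move: (nat_of_ord a) (nat_of_ord b) (Zlt N1 a) (Zlt N1 b); clear -kN => x y h1 h2 h3.
  have := divn_eq (x + y) N; rewrite h3; have : (x + y) %/ N < 2
    by rewrite ltn_divLR; lia.
  by case: (_ %/ N) => [|[|]] //; lia.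
have zzC : forall x y, zig_rel N x y -> zig_rel N y x
  by exact: (graph_sym (zig_rel_graph N10)).
apply/setP => e; apply/idP/idP.
  case/setUP.
    case/imsetP=> a _ ->; rewrite in_set_of //; last exact: zig_rel_graph.
    by have := Zlt N1 a; rewrite /zig_rel next_polygon // => an; case: ifP; lia.
  rewrite inE => /mapP[j]; rewrite mem_iota => hj ->; rewrite /zigzag_edge.
  set k := (j.-1)./2.
  have hsum (a b : 'Z_N) s : (s == 5) || (s == 6) -> (a + b = s%:R)%R -> a <> b ->
    edge a b \in set_of N (zig_rel N).
    move=> hs /(sumE _ _ _ (ltac:(lia) : s < N)) ab nab; rewrite /edge in_set_of //;
      last exact: zig_rel_graph.
    have nab' : nat_of_ord a <> nat_of_ord b by move/val_inj.
    have := Zlt N1 a; have := Zlt N1 b; rewrite /zig_rel !inE; clear -hs ab nab'; lia.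
  have nz m : 0 < m < N -> (m%:R <> 0 :> 'Z_N)%R.
    by move=> Aminus_map e0; have := congr1 (@nat_of_ord _) e0; rewrite Zval //=; lia.
  case: ifP => oj.
    apply: (hsum _ _ 6) => //; first exact: odd_sum.
    move=> e0; apply: (nz (2 + 2 * k)); first by rewrite /k; lia.
    by rewrite natrD natrM -odd_diff e0 subrr.
  apply: (hsum _ _ 5) => //; first exact: even_sum.
  move=> e0; apply: (nz (3 + 2 * k)); first by rewrite /k; lia.
  by rewrite natrD natrM -even_diff e0 subrr.
(* Conversely, writing the end [b] as 4 + k recovers the index: [2k + 1] when the sum is 6 and
   [2k + 2] when it is 5, both equal to [2k + 7 - s]. If this index is out of range, exchanging the
   two ends brings it into range. *)
have spoke (a b : 'Z_N) s : (s == 5) || (s == 6) -> a + b = s \/ a + b = N + s ->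
    4 <= b -> 2 * (b - 4) + 7 - s <= N - 3 -> [set a; b] \in zigzag N.
  move=> hs ab b4 hb; apply/setUP; right; rewrite inE; apply/mapP.
  have abR : (a%:R + b%:R = s%:R :> 'Z_N)%R.
    by rewrite -natrD; case: ab => -> //; rewrite natrD NR add0r.
  have bE : (b = 4 + (b - 4)%:R :> 'Z_N)%R by rewrite -natrD subnKC // natr_Zp.
  have aE : (a = s%:R - (4 + (b - 4)%:R) :> 'Z_N)%R.
    by rewrite !natr_Zp in abR; rewrite -abR -bE addrK.
  exists (2 * (b - 4) + 7 - s); first by rewrite mem_iota; lia.
  rewrite /zigzag_edge /edge; have -> : ((2 * (b - 4) + 7 - s).-1)./2 = b - 4 by lia.
  case/orP: hs => /eqP es; subst s.
    have -> : odd (2 * (b - 4) + 7 - 5) = false by lia.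
    by rewrite -even_end -aE -bE.
  have -> : odd (2 * (b - 4) + 7 - 6) by lia.
  by rewrite -odd_end -aE -bE.
rewrite inE => /existsP[a /existsP[b /andP[ab /eqP->]]] {e}.
have bd (x y : 'Z_N) : (x.+1 == y) || (nat_of_ord x == N.-1) && (nat_of_ord y == 0) ->
    [set x; y] \in zigzag N.
  move=> h; apply/setUP; left; apply/imsetP; exists x; first exact: mem_polygon.
  congr [set _; _]; apply: val_inj; rewrite /= next_polygon //.
  by have := Zlt N1 x; have := Zlt N1 y; case: ifP; lia.
have an := Zlt N1 a; have bn := Zlt N1 b; rewrite /zig_rel !inE in ab.
have [h|nbd1] := boolP ((a.+1 == b) || (nat_of_ord a == N.-1) && (nat_of_ord b == 0));
  first exact: bd.
have [h|nbd2] := boolP ((b.+1 == a) || (nat_of_ord b == N.-1) && (nat_of_ord a == 0));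
  first by rewrite setUC; exact: bd.
have nab : nat_of_ord a <> nat_of_ord b by lia.
have {}ab : [|| a + b == 5, a + b == 6, a + b == N + 5 | a + b == N + 6] by lia.
have [s [hs hab]] : exists s, ((s == 5) || (s == 6)) /\ (a + b = s \/ a + b = N + s).
  by case/or4P: ab => /eqP ->; [exists 5|exists 6|exists 5|exists 6]; split=> //; auto.
have [h|h] := boolP ((4 <= b) && (2 * (b - 4) + 7 - s <= N - 3)).
  by case/andP: h => *; apply: (spoke a b s).
rewrite setUC; apply: (spoke b a s) => //; first by rewrite addnC.
  by clear -h hs hab nab nbd1 nbd2 an bn N10; lia.
by clear -h hs hab nab nbd1 nbd2 an bn N10; lia.
Qed.

(** * Edge sets of the pairs [A] and [B] *)

(** Counting smaller vertices shows at once how removing a vertex shifts the positions of the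
    others. *)
Lemma index_count k (p : seq 'I_k) (x : 'I_k) : sorted ltn (map (@nat_of_ord k) p) ->
  x \in p -> index x p = count (fun y : 'I_k => y < x) p.
Proof.
elim: p => // y p IHp sp; rewrite inE /= [y == x]eq_sym.
have min z : z \in p -> y < z.
  by move=> zp; have /allP := order_path_min ltn_trans sp; apply; exact: map_f.
have [->|nxy] := eqVneq x y.
  rewrite ltnn (eq_in_count (a2 := pred0)) ?count_pred0 // => z /min.
  by move=> yz; rewrite ltnNge ltnW.
by move=> /= xp; rewrite min // IHp //; exact: path_sorted sp.
Qed.

Section SubPolygon.

Variable N : nat.
Hypothesis N1 : 1 < N.

Definition sub_polygon (D : seq nat) (q : seq 'Z_N) : Prop :=
  sorted ltn (map (@nat_of_ord _) q) /\ forall x, (x \in q) = (nat_of_ord x \notin D).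

Lemma sub_polygon0 : sub_polygon [::] (polygon N).
Proof. by split=> [|x]; [exact: sorted_polygon|rewrite mem_polygon]. Qed.

Lemma sub_polygon_uniq D q : sub_polygon D q -> uniq q.
Proof.
case=> sq _; have := sorted_uniq ltn_trans ltnn sq.
by rewrite map_inj_uniq //; exact: val_inj.
Qed.

Lemma sub_polygon_rem D q k : k < N -> sub_polygon D q ->
  sub_polygon (k :: D) (rem (k%:R)%R q).
Proof.
move=> kN gq; have uq := sub_polygon_uniq gq; case: gq => sq mq; split.
  by apply: subseq_sorted sq; [exact: ltn_trans|apply: map_subseq; exact: rem_subseq].
move=> x; rewrite mem_rem_uniq // !inE mq negb_or; congr (_ && _).
by rewrite -val_eqE /= Zval.
Qed.

Lemma sub_polygon_index D q k (x : 'Z_N) : k < N -> k \notin D -> sub_polygon D q ->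
  nat_of_ord x \notin k :: D -> index x (rem (k%:R)%R q) = index x q - (k < x).
Proof.
move=> kN kD gq xD; have [sr mr] := sub_polygon_rem kN gq; have [sq mq] := gq.
have xq : x \in q by rewrite mq; apply: contra xD; rewrite inE orbC => ->.
have kq : (k%:R)%R \in q by rewrite mq Zval.
rewrite !index_count // ?mr //.
by rewrite (permP (perm_to_rem kq)) /= Zval // addKn.
Qed.

Lemma sub_polygon_size D q k : k < N -> k \notin D -> sub_polygon D q ->
  size (rem (k%:R)%R q) = (size q).-1.
Proof. by move=> kN kD [_ mq]; rewrite size_rem // mq Zval. Qed.

Lemma sub_polygon_succ D q a b : sub_polygon D q -> a < b -> b < N ->
  a \notin D -> b \notin D -> (forall c, a < c < b -> c \in D) ->
  next q (a%:R)%R = (b%:R)%R.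
Proof.
move=> [sq mq] ab bN aD bD h; have aN : a < N by lia.
apply: next_succ; rewrite ?mq ?Zval // => c; rewrite mq => cD.
by apply: contra cD; exact: h.
Qed.

Lemma sub_polygon_wrap D q a b : sub_polygon D q -> a < N -> b < N ->
  a \notin D -> b \notin D -> (forall c, c < N -> c \notin D -> b <= c <= a) ->
  next q (a%:R)%R = (b%:R)%R.
Proof.
move=> [sq mq] aN bN aD bD h.
by apply: next_wrap; rewrite ?mq ?Zval // => c; rewrite mq => cD; apply: h => //;
  exact: Zlt.
Qed.

Lemma val_delmap q a b (x : 'Z_N) : a < N -> b < N -> next q (a%:R)%R = (b%:R)%R ->
  nat_of_ord (delmap q (a%:R)%R x) = if nat_of_ord x == a then b else x.
Proof.
move=> aN bN e; rewrite /delmap e -val_eqE /= Zval //.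
by case: ifP; rewrite ?Zval.
Qed.

End SubPolygon.

Lemma val_label (V : finType) n (p : seq V) v l (x : V) : 1 < n -> index v p <= n ->
  nat_of_ord (label p v (l%:R : 'Z_n)%R x) = (index x p + l + (n - index v p)) %% n.
Proof.
move=> n1 jn; rewrite -val_Zp_nat // /label; congr nat_of_ord.
rewrite !natrD natrB // pchar_Zp // sub0r -!addrA; congr (_ + _)%R; exact: addrC.
Qed.

Lemma modn_wrap n k : k < n + n -> k %% n = wrap n k.
Proof.
rewrite /wrap; case: ifP => [kn _|kn k2]; first by rewrite modn_small.
have nk : n <= k by lia.
by rewrite -{1}(subnK nk) modnDr modn_small //; lia.
Qed.

Lemma label_inj (V : finType) n (p : seq V) v (l : 'Z_n) x y : 1 < n -> size p <= n ->
  x \in p -> y \in p -> label p v l x = label p v l y -> x = y.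
Proof.
move=> n1 sp xp yp /addIr/addIr/(congr1 (@nat_of_ord _)).
have lt z : z \in p -> index z p < n.
  by move=> zp; apply: leq_trans sp; rewrite index_mem.
by rewrite !Zval ?lt // => e; rewrite -(nth_index x xp) -(nth_index x yp) e.
Qed.

(** This reduces both triangulations of the pair A_n to a pointwise computation: the final label
    [h x] of each zigzag vertex [x]. *)
Lemma relabel_deletions n N (s : seq 'Z_N) (v : 'Z_N) (l : 'Z_n) (h : nat -> nat) :
  10 < N -> 1 < n -> graph n (push N h (zig_rel N)) ->
  let q := foldl (fun q a => rem a q) (polygon N) s in
  let G := delmaps s (polygon N) in
  (forall x, nat_of_ord (label q v l (G x)) = h x) ->
  size q <= n -> (forall x, G x \in q) ->
  (let: (p, T) := deletions s (polygon N) (zigzag N) in relabel p v l T) =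
  set_of n (push N h (zig_rel N)).
Proof.
move=> N10 n1 gP q G lh sq Gq; have N1 : 1 < N by lia.
have gZ := zig_rel_graph N10.
rewrite zigzag_set_of // deletionsE; last exact: set_of_pairs.
rewrite relabelE; first 1 last.
- exact: push_set_pairs.
- move=> u w /push_setP[x [y [_ _ /set2_eqP exy]]] nuw.
  apply: contra nuw => /eqP luw; apply/eqP; apply: label_inj luw => //.
    by case: exy => -[-> _].
  by case: exy => -[_ ->].
by rewrite push_set_comp; apply: push_set_of => // x; exact: lh.
Qed.

Lemma Aminus_set_of n : 6 < n -> Aminus n = set_of n (Aminus_rel n).
Proof.
move=> n6; have n1 : 1 < n by lia.
have N10 : 10 < n + 4 by lia.
have eH : Aminus_map n = fun x => wrap n (Aminus_pos (n + 4)./2 x) by [].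
have gP := Aminus_rel_graph n6; rewrite /Aminus /Aminus_rel eH in gP *.
have : (n + 4)./2 * 2 <= n + 4 <= (n + 4)./2 * 2 + 1 by lia.
have nN : n = n + 4 - 4 by lia.
set N := n + 4 in N10 nN gP *; set H := N./2 => hH.
have N1 : 1 < N by lia.
have bar0 : bar 0%R = (H%:R : 'Z_N)%R by exact: add0r.
have bar1 : bar 1%R = ((H.+1)%:R : 'Z_N)%R by exact: (esym (natrD _ 1 H)).
rewrite bar0 bar1 -[X in [:: X, _, _ & _]]/((0%:R)%R) -[X in [:: _, X, _ &
  _]]/((1%:R)%R).
have g0 := sub_polygon0 N1.
have g1 : sub_polygon _ _ := sub_polygon_rem N1 (ltac:(lia) : 0 < N) g0.
have g2 : sub_polygon _ _ := sub_polygon_rem N1 (ltac:(lia) : 1 < N) g1.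
have g3 : sub_polygon _ _ := sub_polygon_rem N1 (ltac:(lia) : H < N) g2.
set s := [:: _; _; _; _].
(* Deletions cascade: 0 moves to 1 and both then to 2; likewise [H] moves to [H + 1] and both then
   to [H + 2]. *)
have GE (x : 'Z_N) : nat_of_ord (delmaps s (polygon N) x) =
    if x <= 1 then 2 else if (nat_of_ord x == H) || (nat_of_ord x == H.+1) then H.+2
      else x.
  rewrite /s /=.
  rewrite (@val_delmap _ N1 _ H.+1 H.+2); [|lia|lia|].
    rewrite (@val_delmap _ N1 _ H H.+1); [|lia|lia|].
      rewrite (@val_delmap _ N1 _ 1 2); [|lia|lia|].
        rewrite (@val_delmap _ N1 _ 0 1); [|lia|lia|].
          by do ![case: ifP]; lia.
        by apply: (sub_polygon_succ N1 g0) => //; lia.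
      by apply: (sub_polygon_succ N1 g1) => //; rewrite ?inE //; lia.
    by apply: (sub_polygon_succ N1 g2); rewrite ?inE //; lia.
  by apply: (sub_polygon_succ N1 g3); rewrite ?inE //; lia.
set q := foldl (fun q a => rem a q) (polygon N) s.
have idx (x : 'Z_N) : nat_of_ord x \notin [:: H.+1; H; 1; 0] ->
    index x q = x - (0 < x) - (1 < x) - (H < x) - (H.+1 < x).
  move=> xD; rewrite /q /s /=.
  rewrite (sub_polygon_index N1 _ _ g3) //; try by rewrite ?inE; lia.
  rewrite (sub_polygon_index N1 _ _ g2) //; try by (move: xD; rewrite ?inE; lia).
  rewrite (sub_polygon_index N1 _ _ g1) //; try by (move: xD; rewrite ?inE; lia).
  rewrite (sub_polygon_index N1 _ _ g0) //; try by (move: xD; rewrite ?inE; lia).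
  by rewrite /polygon index_enum_ord.
have i2 : index (2%:R : 'Z_N)%R q = 0.
  by rewrite idx Zval //= ?inE; lia.
have lh (x : 'Z_N) : nat_of_ord (label q (2%:R)%R (2%:R : 'Z_n)%R (delmaps s (polygon
  N) x)) =
    wrap n (Aminus_pos H x).
  have xN := Zlt N1 x.
  rewrite val_label // i2 // subn0 modnDr idx; last by rewrite !inE GE;
    do ![case: ifP]; lia.
  rewrite GE modn_wrap; last by do ![case: ifP]; lia.
  by congr wrap; rewrite /Aminus_pos; do ![case: ifP]; lia.
have [_ m4] := sub_polygon_rem N1 (ltac:(lia) : H.+1 < N) g3.
apply: (@relabel_deletions n N s (2%:R)%R (2%:R)%R _ N10 n1 gP lh).
  rewrite /= (sub_polygon_size N1 _ _ g3) ?(sub_polygon_size N1 _ _ g2)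
    ?(sub_polygon_size N1 _ _ g1)
    ?(sub_polygon_size N1 _ _ g0) ?size_polygon //; by rewrite ?inE; lia.
by move=> x; rewrite m4 GE !inE; have := Zlt N1 x; do ![case: ifP]; lia.
Qed.

Lemma Aplus_set_of n : 6 < n -> Aplus n = set_of n (Aplus_rel n).
Proof.
move=> n6; have n1 : 1 < n by lia.
have N10 : 10 < n + 4 by lia.
have eH : Aplus_map n = fun x => wrap n (Aplus_pos n (n + 4)./2 x) by [].
have gP := Aplus_rel_graph n6; rewrite /Aplus /Aplus_rel eH in gP *.
have : (n + 4)./2 * 2 <= n + 4 <= (n + 4)./2 * 2 + 1 by lia.
have nN : n = n + 4 - 4 by lia.
set N := n + 4 in N10 nN gP *; set H := N./2 => hH.
have N1 : 1 < N by lia.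
have bar4 : bar 4%R = ((4 + H)%:R : 'Z_N)%R by exact: (esym (natrD _ 4 H)).
have bar5 : bar 5%R = ((5 + H)%:R : 'Z_N)%R by exact: (esym (natrD _ 5 H)).
rewrite bar4 bar5.
have g0 := sub_polygon0 N1.
have g1 : sub_polygon _ _ := sub_polygon_rem N1 (ltac:(lia) : 4 < N) g0.
have g2 : sub_polygon _ _ := sub_polygon_rem N1 (ltac:(lia) : 5 < N) g1.
have g3 : sub_polygon _ _ := sub_polygon_rem N1 (ltac:(lia) : 4 + H < N) g2.
set s := [:: _; _; _; _].
(* For [N] equal to 11 or 12 the deleted vertex [5 + H] is the last one, and its successor is 0. *)
pose b := if 6 + H < N then 6 + H else 0.
have bN : b < N by rewrite /b; case: ifP; lia.
have GE (x : 'Z_N) : nat_of_ord (delmaps s (polygon N) x) =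
    if (nat_of_ord x == 4) || (nat_of_ord x == 5) then 6 else
    if (nat_of_ord x == 4 + H) || (nat_of_ord x == 5 + H) then b else x.
  rewrite /s /=.
  rewrite (@val_delmap _ N1 _ (5 + H) b) //; [|lia|].
    rewrite (@val_delmap _ N1 _ (4 + H) (5 + H)); [|lia|lia|].
      rewrite (@val_delmap _ N1 _ 5 6); [|lia|lia|].
        rewrite (@val_delmap _ N1 _ 4 5); [|lia|lia|].
          by do ![case: ifP]; try lia; rewrite /=; lia.
        by apply: (sub_polygon_succ N1 g0) => //; lia.
      by apply: (sub_polygon_succ N1 g1) => //; rewrite ?inE //; lia.
    by apply: (sub_polygon_succ N1 g2); rewrite ?inE //; lia.
  rewrite /b; case: ifP => h.
    apply: (sub_polygon_succ N1 g3); rewrite ?inE //; lia.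
  by apply: (sub_polygon_wrap N1 g3); rewrite ?inE //; try lia; move=> c;
    rewrite !inE; lia.
set q := foldl (fun q a => rem a q) (polygon N) s.
have idx (x : 'Z_N) : nat_of_ord x \notin [:: 5 + H; 4 + H; 5; 4] ->
    index x q = x - (4 < x) - (5 < x) - (4 + H < x) - (5 + H < x).
  move=> xD; rewrite /q /s /=.
  rewrite (sub_polygon_index N1 _ _ g3) //; try by rewrite ?inE; lia.
  rewrite (sub_polygon_index N1 _ _ g2) //; try by (move: xD; rewrite ?inE; lia).
  rewrite (sub_polygon_index N1 _ _ g1) //; try by (move: xD; rewrite ?inE; lia).
  rewrite (sub_polygon_index N1 _ _ g0) //; try by (move: xD; rewrite ?inE; lia).
  by rewrite /polygon index_enum_ord.
have i2 : index (2%:R : 'Z_N)%R q = 2.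
  by rewrite idx Zval //= ?inE; lia.
have lh (x : 'Z_N) : nat_of_ord (label q (2%:R)%R (1%:R : 'Z_n)%R (delmaps s (polygon
  N) x)) =
    wrap n (Aplus_pos n H x).
  have xN := Zlt N1 x.
  rewrite val_label // i2 // idx; last by rewrite !inE GE /b; do ![case: ifP]; lia.
  rewrite GE modn_wrap; last by rewrite /b; do ![case: ifP]; lia.
  have [h45|h45] := boolP ((nat_of_ord x == 4) || (nat_of_ord x == 5)).
    by congr wrap; rewrite /Aplus_pos; clear -nN N10 hH h45; do ![case: ifP]; lia.
  have [hb|hb] := boolP ((nat_of_ord x == 4 + H) || (nat_of_ord x == 5 + H)).
    have -> : Aplus_pos n H x = n + H + 1.
      by rewrite /Aplus_pos; clear -nN N10 hH hb; do ![case: ifP]; lia.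
    by rewrite /wrap /b; clear -nN N10 hH; do ![case: ifP]; lia.
  by congr wrap; rewrite /Aplus_pos; clear -nN N10 hH xN h45 hb; do ![case: ifP]; lia.
have [_ m4] := sub_polygon_rem N1 (ltac:(lia) : 5 + H < N) g3.
apply: (@relabel_deletions n N s (2%:R)%R (1%:R)%R _ N10 n1 gP lh).
  rewrite /= (sub_polygon_size N1 _ _ g3) ?(sub_polygon_size N1 _ _ g2)
    ?(sub_polygon_size N1 _ _ g1)
    ?(sub_polygon_size N1 _ _ g0) ?size_polygon //; by rewrite ?inE; lia.
by move=> x; rewrite m4 GE !inE /b; have := Zlt N1 x; do ![case: ifP]; lia.
Qed.

(** The edge 13 makes 2 an ear, with 12 and 23 as its only possible edges. Merging 2 into 3
    collapses 23 and sends 12 onto the image of 13, so the image is the same as after removing these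
    two edges. *)
Lemma cut2_set_of n E : 6 < n -> graph n.+1 E -> E 1 3 ->
  cut2 (set_of n.+1 E) = set_of n (push n.+1 (cut_map n) E).
Proof.
move=> n6 gE e13; have N1 : 1 < n.+1 by lia.
have n1 : 1 < n by lia.
have g1 : sub_polygon _ _ :=
  sub_polygon_rem N1 (ltac:(lia) : 2 < n.+1) (sub_polygon0 N1).
have [_ m1] := g1.
rewrite /cut2; set q := rem _ _; set T := _ :\: _.
have TE (x y : 'Z_n.+1) : [set x; y] \in T ->
  [/\ E x y, nat_of_ord x <> 2 & nat_of_ord y <> 2].
  case/setDP; rewrite in_set_of // => exy ndiag.
  have no2 (z w : 'Z_n.+1) : E z w -> [set z; w] \notin [set edge 1%R 2%R;
    edge 2%R 3%R] ->
      nat_of_ord z <> 2.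
    move=> zw nd z2; have ez : z = (2%:R)%R by rewrite -(natr_Zp z) z2.
    have nw := graph_neq gE zw.
    have [w1|w1] := eqVneq (nat_of_ord w) 1.
      have ew : w = (1%:R)%R by rewrite -(natr_Zp w) w1.
      by case/negP: nd; apply/set2P; left; rewrite ez ew /edge setUC.
    have [w3|w3] := eqVneq (nat_of_ord w) 3.
      have ew : w = (3%:R)%R by rewrite -(natr_Zp w) w3.
      by case/negP: nd; apply/set2P; right; rewrite ez ew.
    apply: (graph_nx gE _ e13 zw); move: nw w1 w3; rewrite z2; clear; cyc.
  split=> //; first exact: no2 exy ndiag.
  by apply: (no2 y x); [exact: (graph_sym gE)|rewrite setUC].
have idx (x : 'Z_n.+1) : nat_of_ord x <> 2 -> index x q = x - (2 < x).
  move=> x2; rewrite /q (sub_polygon_index N1 _ _ (sub_polygon0 N1)) ?inE //; try lia.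
  by rewrite /polygon index_enum_ord.
have i3 : index (3%:R : 'Z_n.+1)%R q = 2 by rewrite idx Zval //=; lia.
have le (x : 'Z_n.+1) : nat_of_ord x <> 2 ->
    nat_of_ord (label q (3%:R)%R (3%:R : 'Z_n)%R x) = cut_map n x.
  move=> x2; have xn := Zlt N1 x.
  rewrite val_label // i3; last lia.
  have -> : index x q + 3 + (n - 2) = index x q + 1 + n by lia.
  rewrite modnDr idx // modn_wrap; last by lia.
  by congr wrap; clear -x2; do ![case: ifP]; lia.
have mono := cut_map_monotone n6; have gP := push_graph mono gE.
rewrite relabelE; first 1 last.
- move=> e; case/setDP=> /(set_of_pairs gE); by [].
- move=> x y /TE[_ x2 y2] nxy; apply: contra nxy => /eqP lxy; apply/eqP.
  apply: label_inj lxy => //; rewrite ?m1 ?inE; try exact/eqP.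
  by rewrite (sub_polygon_size N1 _ _ (sub_polygon0 N1)) // size_polygon.
apply/setP => e; apply/push_setP/idP.
  case=> x [y [/TE[exy x2 y2] nl ->]]; rewrite in_set_of // !le //.
  by apply: push_edge => // ee; case/eqP: nl; apply: ord_inj; rewrite !le.
rewrite inE => /existsP[a /existsP[b /andP[/pushP[]// nab [x [y [xy ea eb]]] /eqP->]]].
have [X [Y [XY X2 Y2 [eX eY]]]] : exists X Y, [/\ E X Y, X <> 2, Y <> 2 &
    cut_map n X = a /\ cut_map n Y = b].
  have l23 : cut_map n 2 = cut_map n 3 by rewrite /cut_map /=.
  have e31 := graph_sym gE e13.
  have nxy := graph_neq gE xy.
  have at2 z : E 2 z -> z = 1 \/ z = 3.
    move=> zz2; have := graph_neq gE zz2; have [->|z1] := eqVneq z 1; first by left.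
    have [->|z3] := eqVneq z 3; first by right.
    by move=> z2; exfalso; apply: (graph_nx gE _ e13 zz2); clear -z1 z2 z3; cyc.
  have [x2|x2] := eqVneq x 2.
    subst x; have [y1|y3] := at2 _ xy; last by case: nab; rewrite -ea -eb y3.
    by exists 3, 1; split=> //; split; rewrite -?l23 // -y1.
  have [y2|y2] := eqVneq y 2.
    subst y; have [x1|x3] := at2 _ (graph_sym gE xy); last by case: nab;
      rewrite -ea -eb x3.
    by exists 1, 3; split=> //; split; rewrite -?l23 // -x1.
  by exists x, y; split=> //; exact/eqP.
have Xn := graph_lt gE XY; have Yn := graph_ltr gE XY.
exists (X%:R)%R, (Y%:R)%R; split.
- rewrite !inE; apply/andP; split; last first.
    by apply/existsP; exists (X%:R)%R; apply/existsP; exists (Y%:R)%R;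
      rewrite !Zval // XY eqxx.
  rewrite negb_or; apply/andP; split; apply/eqP =>
    /set2_eqP[] [] /(congr1 (@nat_of_ord _)) e1
    /(congr1 (@nat_of_ord _)) e2; move: e1 e2; rewrite !Zval //=; clear -X2 Y2 n6; lia.
- by apply/eqP => /(congr1 (@nat_of_ord _)); rewrite !le ?Zval // eX eY.
- by congr [set _; _]; apply: ord_inj; rewrite le ?Zval.
Qed.

Lemma flip_set_of n E E' x y z t : 1 < n -> graph n E -> flip_at E E' x y z t ->
  flip (polygon n) (set_of n E) [set (x%:R)%R; (z%:R)%R] = set_of n E'.
Proof.
move=> n1 gE fl; apply: (@flipE n n1 _ x y z t E' (set_of_noncrossing n1 gE)).
have rE := rel_of_set_of n1 gE; have [cy xz xy yz zt tx EE] := fl.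
by split; rewrite ?rE // => u v; rewrite rE EE.
Qed.

Lemma Bminus_set_of n : 11 < n -> Bminus n = set_of n (Bminus_rel n).
Proof.
move=> n11; have n6 : 6 < n.+1 by lia.
have N1 : 1 < n.+1 by lia.
have gA := Aminus_rel_graph n6; have [f1 f2 f3] := precut_flips n11.
have gE1 := flip_graph gA f1; have gE2 := flip_graph gE1 f2.
rewrite /Bminus Aminus_set_of //.
have -> : edge 2%R 5%R = [set (2%:R)%R; (5%:R)%R] :> {set 'Z_n.+1} by [].
rewrite (flip_set_of N1 gA f1).
have -> : edge 2%R 4%R = [set (2%:R)%R; (4%:R)%R] :> {set 'Z_n.+1} by [].
rewrite (flip_set_of N1 gE1 f2).
have -> : edge 2%R 6%R = [set (2%:R)%R; (6%:R)%R] :> {set 'Z_n.+1} by [].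
rewrite (flip_set_of N1 gE2 f3); apply: cut2_set_of; [lia|exact: precut_graph|].
by rewrite /precut_rel /switch.
Qed.

Lemma Bplus_set_of n : 11 < n -> Bplus n = set_of n (Bplus_rel n).
Proof.
move=> n11; have n6 : 6 < n.+1 by lia.
have [[_ _ a13 _ _] _] := Aplus_rel_mem n11.
by rewrite /Bplus Aplus_set_of //; apply: cut2_set_of => //;
  [lia|exact: Aplus_rel_graph].
Qed.

(** * Flip paths *)

Section Delta.

Variables (V : finType) (p : seq V).

Lemma delta_le P s : flip_path p P s -> delta p P <= size s.
Proof.
move=> fs; rewrite /delta; set a := (fun k => _); set K := #|_|.
have [ltK|leK] := ltnP (size s) K; last first.
  by apply: leq_trans (find_size _ _) _; rewrite size_iota.
rewrite leqNgt; apply/negP => /(before_find 0).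
rewrite nth_iota // add0n /a => /existsP[].
by exists (in_tuple s).
Qed.

Lemma delta_le_card P : delta p P <= #|{: {set {set V}}}|.
Proof. by rewrite -[X in _ <= X](size_iota 0); exact: find_size. Qed.

Lemma delta_witness P : delta p P < #|{: {set {set V}}}| ->
  exists s : (delta p P).-tuple {set {set V}}, flip_path p P s.
Proof.
rewrite -[X in _ < X](size_iota 0) -has_find => h.
have := nth_find 0 h; rewrite nth_iota ?add0n; first by move/existsP.
by move: h; rewrite has_find size_iota.
Qed.

End Delta.

Lemma card_set_set (V : finType) : #|{: {set {set V}}}| = 2 ^ (2 ^ #|V|).
Proof.
have cs (W : finType) : #|{: {set W}}| = 2 ^ #|W|.
  by rewrite -[LHS]cardsT -powersetT card_powerset cardsT.
by rewrite !cs.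
Qed.

(** Applied to the links along a geodesic, this isolates a single flip that takes the link of {3,4}
    directly from its initial to its final value. *)
Lemma split_once (T : Type) (K : eqType) (L : T -> K) x s :
  count id (pairmap (fun u v => L u != L v) x s) <= 1 -> L x != L (last x s) ->
  exists s1 y s2, [/\ s = s1 ++ y :: s2, L (last x s1) = L x & L y = L (last y s2)].
Proof.
have const y t : count id (pairmap (fun u v => L u != L v) y t) = 0 ->
  L y = L (last y t).
  elim: t y => //= z t IHt y; have [->|//] := eqVneq (L y) (L z).
  by rewrite add0n => /IHt.
elim: s x => [|y s IHs] x /=; first by rewrite eqxx.
have [exy|nxy] := eqVneq (L x) (L y) => /= h nl.
  have [|s1 [z [s2 [-> e1 e2]]]] := IHs y h; first by rewrite -exy.
  by exists (y :: s1), z, s2; rewrite exy.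
by exists [::], y, s; split=> //; apply: const; lia.
Qed.

(** Passing from a relation to an edge set and back gives the relation only up to pointwise
    equality, so the notions in use have to respect it. *)
Lemma eq_flip_at E1 E2 E1' E2' a b c d : E1 =2 E2 -> E1' =2 E2' ->
  flip_at E1 E1' a b c d -> flip_at E2 E2' a b c d.
Proof.
move=> e e' [cy ac ab bc cd da EE]; split; rewrite -?e // => x y.
by rewrite -e' EE e.
Qed.

Lemma eq_triang n E1 E2 : E1 =2 E2 -> triang n E1 -> triang n E2.
Proof.
move=> e [[s l i nx] m]; split; first split.
- by move=> x y; rewrite -!e; exact: s.
- by move=> x y; rewrite -!e; exact: l.
- by move=> x y; rewrite -!e; exact: i.
- by move=> a b c d; rewrite -!e; exact: nx.
by move=> a b an bn ab h; rewrite -e; apply: m => // c d cy; rewrite e; exact: h.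
Qed.

Lemma eq_phi n w E1 E2 : E1 =2 E2 -> phi n w E1 = phi n w E2.
Proof. by move=> e; apply: eq_bigr => t _; rewrite /tri !e. Qed.

Lemma eq_push n g E1 E2 : E1 =2 E2 -> push n g E1 =2 push n g E2.
Proof.
move=> e u v; rewrite /push; congr (_ && _).
by apply: eq_has => x; apply: eq_has => y; rewrite e.
Qed.

(** * Contracting a flip path *)

Section Contraction.

Variable n : nat.
Hypothesis n11 : 11 < n.
Local Notation p := (polygon n).
Local Notation p' := (polygon (n - 5)).
Local Notation ph T := (phi n (weight n) (rel_of T)).
Implicit Types T U : {set {set 'Z_n}}.

Let n1 : 1 < n. Proof. by lia. Qed.
Let m1 : 1 < n - 5. Proof. by lia. Qed.

Definition contract T : {set {set 'Z_(n - 5)}} :=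
  set_of (n - 5) (push n (contr n) (rel_of T)).

Lemma contract_flip T U a b c d : triang n (rel_of T) ->
  flip_at (rel_of T) (rel_of U) a b c d ->
  [/\ triang n (rel_of U),
      (`|ph U - ph T| <= (contract T == contract U)%:Z)%R &
      contract T <> contract U -> flip_rel p' (contract T) (contract U)].
Proof.
move=> tT fl; have tU := flip_triang tT fl.
have [v1 [v2 [v3 [v4 [l12 l23 l34 l4n fs]]]]] := sorted_flip tT fl.
have mg := contr_monotone n11.
have sg u : u < n - 5 -> exists2 x, x < n & contr n x = u by exact: contr_surj.
have tP := push_triang mg tT sg.
have coll : [|| contr n v1 == contr n v2, contr n v2 == contr n v3 |
    contr n v3 == contr n v4] -> contract T = contract U.
  move=> h; apply: eq_set_of.
  have h' : [|| contr n v1 == contr n v2, contr n v2 == contr n v3,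
    contr n v3 == contr n v4 | contr n v4 == contr n v1].
    by case/or3P: h => ->; rewrite ?orbT.
  case: fs => fs; first exact: (push_flip_collapsed mg tT fs).
  by move=> u v; rewrite (push_flip_collapsed mg tU fs).
split=> //.
- have gain := weight_gain n11 l12 l23 l34 l4n.
  have le : ([|| contr n v1 == contr n v2,
    contr n v2 == contr n v3 | contr n v3 == contr n v4]%:Z
      <= (contract T == contract U)%:Z)%R.
    by case: (boolP [|| _, _ | _]) => [/coll ->|_]; rewrite ?eqxx //; case: (_ == _).
  case: fs => fs.
    by rewrite (phi_flip (weight n) tT fs l12 l23 l34); clear -gain le; lia.
  by rewrite (phi_flip (weight n) tU fs l12 l23 l34); clear -gain le; lia.
move=> neq; have nco : ~~ [|| contr n v1 == contr n v2, contr n v2 == contr n v3 |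
    contr n v3 == contr n v4] by apply/negP => /coll.
rewrite !negb_or in nco; case/and3P: nco => c12 c23 c34.
have cy := contr_cyc n11 l12 l23 l34 l4n c12 c23 c34.
rewrite /contract; case: fs => fs.
  by apply: (flip_rel_set_of m1 tP (push_flip mg tT fs cy)).
have tP' := push_triang mg tU sg; have [gP' _] := tP'.
by apply: (flip_rel_set_of m1 tP (flip_sym gP' (push_flip mg tU fs cy))).
Qed.

Lemma flip_rel_flip_at T U : flip_rel p T U -> triang n (rel_of T) /\
  (U = T \/ exists a b c d, flip_at (rel_of T) (rel_of U) a b c d).
Proof.
case/(flip_rel_step n1) => tT h; have tr := triangulation_triang n1 tT; split=> //.
case: h => [->|[E [a [b [c [d [fl ->]]]]]]]; [by left|right].
have [gT _] := tr; have gE := flip_graph gT fl.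
exists a, b, c, d; apply: eq_flip_at fl => // x y.
by rewrite rel_of_set_of.
Qed.

(** [k] counts the steps that disappear; only these can raise the weight, by at most one each. *)
Lemma contract_path s T : triang n (rel_of T) -> path (flip_rel p) T s ->
  exists s' k, [/\ path (flip_rel p') (contract T) s',
    last (contract T) s' = contract (last T s), size s' + k = size s,
    (ph (last T s) <= ph T + k%:Z)%R & triang n (rel_of (last T s))].
Proof.
elim: s T => [|U s IHs] T tT /=.
  by move=> _; exists [::], 0; split=> //=; rewrite addr0.
case/andP=> /flip_rel_flip_at[_ TU] pUs.
have [tU dp st] : [/\ triang n (rel_of U),
  (`|ph U - ph T| <= (contract T == contract U)%:Z)%R &
      contract T <> contract U -> flip_rel p' (contract T) (contract U)].
  case: TU => [->|[a [b [c [d fl]]]]]; last exact: contract_flip fl.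
  by split=> //; rewrite subrr eqxx.
have [s' [k [ps' ls' sz le tl]]] := IHs U tU pUs.
have [e|ne] := eqVneq (contract T) (contract U).
  exists s', k.+1; rewrite e; split=> //; first by rewrite addnS sz.
  by move: dp le; rewrite e eqxx; clear; lia.
exists (contract U :: s'), k; split=> //=.
- by rewrite ps' andbT; apply: st; exact/eqP.
- by rewrite addSn sz.
- by move: dp le; rewrite (negbTE ne); clear; lia.
Qed.

(** Two common neighbours of 3 and 4 lie on the same side of this boundary edge, and their edges to
    3 and 4 would cross. *)
Lemma link3 T x : graph n (rel_of T) -> rel_of T 3 x -> rel_of T 4 x ->
  link p T (3%:R)%R = Some (x%:R)%R.
Proof.
move=> gT e3 e4; have xn := graph_ltr gT e3.
have nx3 : next p (3%:R)%R = (4%:R)%R.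
  by apply: ord_inj; rewrite next_polygon // !Zval //; try lia; case: ifP; lia.
have hx : ([set (3%:R)%R; (x%:R)%R] \in T) && ([set next p (3%:R)%R; (x%:R)%R] \in T).
  by rewrite nx3; case/and3P: e3 => _ _ ->; case/and3P: e4.
rewrite /link; case: pickP => [y|/(_ (x%:R)%R)]; last by rewrite hx.
rewrite nx3 => /andP[y3 y4]; congr Some; apply: ord_inj; rewrite Zval //.
have {}y3 : rel_of T 3 y by rewrite /rel_of natr_Zp y3 Zlt //; lia.
have {}y4 : rel_of T 4 y by rewrite /rel_of natr_Zp y4 Zlt //; lia.
have := graph_neq gT y3; have := graph_neq gT y4; have := graph_neq gT e3;
  have := graph_neq gT e4.
move=> q1 q2 q3 q4; apply/eqP/negPn/negP => nyx.
have [c|c] : cyc4 3 4 y x \/ cyc4 3 4 x y by clear -q1 q2 q3 q4 nyx; cyc.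
  exact: (graph_nx gT c y3 e4).
exact: (graph_nx gT c e3 y4).
Qed.

Lemma linkP T x : x < n -> link p T (3%:R)%R = Some (x%:R)%R ->
  rel_of T 3 x /\ rel_of T 4 x.
Proof.
move=> xn; have nx3 : next p (3%:R)%R = (4%:R)%R.
  by apply: ord_inj; rewrite next_polygon // !Zval //; try lia; case: ifP; lia.
rewrite /link; case: pickP => // y /andP[y3 y4] [ey]; subst y; rewrite nx3 in y4.
by rewrite /rel_of y3 y4 xn; lia.
Qed.

(** The edge 36 crosses the one from 4 to [n - 1], so this flip must exchange them, and its
    quadrilateral is 3, 4, 6, [n - 1]. The adjacent corners 4 and 6 are identified, and all four
    triangles involved have weight 0. *)
Lemma main_flip T U : flip_rel p T U -> rel_of T 3 6 -> rel_of T 4 6 ->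
  rel_of U 3 (n - 1) -> rel_of U 4 (n - 1) ->
  [/\ triang n (rel_of U), contract T = contract U & ph T = ph U].
Proof.
case/flip_rel_flip_at=> tT TU t36 t46 u3n u4n.
have [gT _] := tT.
have x36 : cyc4 3 4 6 (n - 1) by clear -n11; cyc.
have nt4n : ~ rel_of T 4 (n - 1) by move=> h; exact: (graph_nx gT x36 t36 h).
case: TU => [e|[a [b [c [d fl]]]]]; first by rewrite e in u4n.
have tU := flip_triang tT fl; have [gU _] := tU.
have nu36 : ~ rel_of U 3 6 by move=> h; exact: (graph_nx gU x36 h u4n).
have [cy ac ab bc cd da EE] := fl.
have e1 : same_pair 4 (n - 1) b d.
  by move: u4n; rewrite EE => /orP[//|/andP[h _]]; case: nt4n.
have e2 : same_pair 3 6 a c.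
  by apply/negPn/negP => h; apply: nu36; rewrite EE t36 h orbT.
have fl' : flip_at (rel_of T) (rel_of U) 3 4 6 (n - 1).
  case/orP: e2 => /andP[/eqP ea /eqP ec]; case/orP: e1 => /andP[/eqP eb /eqP ed];
    subst a b c d => //.
  - by exfalso; move: cy; clear -n11; cyc.
  - exact: (flip_rot gT fl).
have l4n : n - 1 < n by clear -n11; lia.
have l34 : 6 < n - 1 by clear -n11; lia.
split=> //.
  apply: eq_set_of; apply: (push_flip_collapsed (contr_monotone n11) tT fl').
  by rewrite /contr /= eqxx orbT.
rewrite (phi_flip (weight n) tT fl' (ltac:(done) : 3 < 4) (ltac:(done) : 4 < 6) l34).
by rewrite /flip_gain /weight /=; clear -n11; do ![case: ifP]; lia.
Qed.

(** The contracted triangulation is maximal among noncrossing sets, so being contained in one forces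
    equality. *)
Lemma contract_eq T E : triang n (rel_of T) -> graph (n - 5) E ->
  (forall u v, push n (contr n) (rel_of T) u v -> E u v) ->
    contract T = set_of (n - 5) E.
Proof.
move=> tT gE sub; have mg := contr_monotone n11.
have sg u : u < n - 5 -> exists2 x, x < n & contr n x = u by exact: contr_surj.
have tP := push_triang mg tT sg.
have /maxsetP[_ mx] := triang_triangulation m1 tP.
apply/esym/mx; first exact: set_of_noncrossing.
apply/subsetP => e; rewrite !inE => /existsP[a /existsP[b /andP[ab ee]]].
by apply/existsP; exists a; apply/existsP; exists b; rewrite sub.
Qed.

End Contraction.

Theorem theorem9 (n : nat) (hn : 11 < n) :
  theta (polygon n) (pairB n) (3%R : 'Z_n) <= 1 ->
  delta (polygon (n - 5)) (pairA (n - 5)) + 9 <= delta (polygon n) (pairB n).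
Proof.
move=> hth; have n1 : 1 < n by lia.
have m6 : 6 < n - 5 by lia.
have m1 : 1 < n - 5 by lia.
have [ltK|geK] := ltnP (delta (polygon n) (pairB n)) #|{: {set {set 'Z_n}}}|;
  last first.
  (* Here [delta] of B_n has its default value, [2 ^ (2 ^ n)], while [delta] of A_(n-5) is at most
     [2 ^ (2 ^ (n - 5))]; the gap far exceeds 9. *)
  apply: leq_trans geK; apply: leq_trans (leq_add (delta_le_card _ _) (leqnn 9)) _.
  rewrite !card_set_set !card_ord !Zp_cast //.
  have h16 : 2 ^ 4 <= 2 ^ (2 ^ (n - 5)).
    by rewrite leq_exp2l // -[4]/(2 ^ 2) leq_exp2l //; lia.
  apply: (@leq_trans (2 ^ (2 ^ (n - 5)).+1)); first by rewrite expnS; lia.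
  by rewrite leq_exp2l // ltn_exp2l //; lia.
have [s fs] := delta_witness ltK.
have cnt : count id (pairmap (incident (polygon n) 3%R) (pairB n).1 s) <= 1.
  apply: leq_trans hth; exact: (leq_bigmax_cond s fs).
have szs : size s = delta (polygon n) (pairB n) by exact: size_tuple.
rewrite -{}szs; move: (tval s) fs cnt => {}s /andP[/= ps /eqP ls] cnt.
have gBm := Bminus_rel_graph hn; have gBp := Bplus_rel_graph hn.
have rBm : rel_of (Bminus n) =2 Bminus_rel n by rewrite Bminus_set_of //;
  exact: rel_of_set_of.
have rBp : rel_of (Bplus n) =2 Bplus_rel n by rewrite Bplus_set_of //;
  exact: rel_of_set_of.
have [[b36 b46 _ _] _] := Bminus_rel_mem hn.
have [[_ _ b3n b4n] _] := Bplus_rel_mem hn.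
have lm : link (polygon n) (Bminus n) 3%R = Some (6%:R)%R.
  by apply: link3 => //; rewrite ?rBm // Bminus_set_of //;
    apply: noncrossing_graph => //; exact: set_of_noncrossing.
have lp : link (polygon n) (Bplus n) 3%R = Some ((n - 1)%:R)%R.
  by apply: link3 => //; rewrite ?rBp // Bplus_set_of //;
    apply: noncrossing_graph => //; exact: set_of_noncrossing.
have lne : link (polygon n) (Bminus n) 3%R != link (polygon n) (last (Bminus n) s) 3%R.
  rewrite ls lm lp; apply/eqP => -[] /(congr1 (@nat_of_ord _)); rewrite !Zval //; lia.
have [s1 [U [s2 [es l1 l2]]]] := split_once (L := fun T =>
  link (polygon n) T 3%R) cnt lne.
subst s; move: ps ls; rewrite cat_path last_cat /= => /and3P[ps1 st ps2] ls.
(* The path has at least one flip because the links at its ends differ; since [flip_rel] requires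
   its source to be a triangulation, B_n^- is one. *)
have [W /(flip_rel_flip_at hn)[tm _]] : exists W, flip_rel (polygon n) (Bminus n) W.
  by case: (s1) ps1 st => [_ st|V t /= /andP[h _] _]; [exists U|exists V].
have l6 : link (polygon n) (last (Bminus n) s1) 3%R = Some (6%:R)%R by rewrite l1.
have ln : link (polygon n) U 3%R = Some ((n - 1)%:R)%R by rewrite l2 ls.
have [t36 t46] := linkP hn (ltac:(lia) : 6 < n) l6.
have [u3n u4n] := linkP hn (ltac:(lia) : n - 1 < n) ln.
have [tU cTU phTU] := main_flip hn st t36 t46 u3n u4n.
have [s1' [k1 [ps1' ls1' sz1 le1 _]]] := contract_path hn tm ps1.
have [s2' [k2 [ps2' ls2' sz2 le2 tp]]] := contract_path hn tU ps2.
rewrite ls in ls2' le2 tp.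
have cm : contract (Bminus n) = Aminus (n - 5).
  rewrite Aminus_set_of //; apply: contract_eq => //; first exact: Aminus_rel_graph.
  by move=> u v; rewrite (eq_push _ _ rBm); exact: contr_Bminus.
have cp : contract (Bplus n) = Aplus (n - 5).
  rewrite Aplus_set_of //; apply: contract_eq => //; first exact: Aplus_rel_graph.
  by move=> u v; rewrite (eq_push _ _ rBp); exact: contr_Bplus.
have phm := phi_Bminus hn (eq_triang rBm tm);
  have php := phi_Bplus hn (eq_triang rBp tp).
rewrite -(eq_phi _ _ rBm) in phm; rewrite -(eq_phi _ _ rBp) in php.
have fA : flip_path (polygon (n - 5)) (pairA (n - 5)) (s1' ++ s2').
  rewrite /flip_path /= cat_path last_cat -cm ps1' ls1' cTU ps2' ls2' cp.
  exact: eqxx.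
(* The weight rises from at most -4 to at least 4 and is unchanged by the flip to [U], so
   [k1 + k2 >= 8]; that flip itself supplies the remaining unit of length. *)
have := delta_le fA; rewrite !size_cat /=.
rewrite phTU in le1; clear -le1 le2 phm php sz1 sz2.
lia.
Qed.
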